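(* Consider a planar $3\times 4$ discrete conjugate net with strictly convex faces $F_{i,j}$ ($1\le i\le 3$ rows numbered from bottom to top, $1\le j\le 4$ columns numbered from left to right), vertices $p_{i,j}$ ($0\le i\le 3$, $0\le j\le 4$), and all exterior dihedral angles equal to $0$ (the net is laid out flat without folding). Suppose that the tangents of the halves of the face angles at the six interior vertices are as follows, where for the vertex $p_{i,j}$ the entries UL, UR, LL, LR refer to the faces $F_{i+1,j}$ (upper left), $F_{i+1,j+1}$ (upper right), $F_{i,j}$ (lower left), $F_{i,j+1}$ (lower right), respectively: $$\begin{array}{c|cccc} & \mathrm{UL} & \mathrm{UR} & \mathrm{LL} & \mathrm{LR}\\ \hline p_{1,1} & 2 & \tfrac32 & \tfrac23 & \tfrac12\\ p_{1,2} & \tfrac23 & \tfrac76 & \tfrac67 & \tfrac32\\ p_{1,3} & \tfrac32 & \tfrac{51}{76} & \tfrac{76}{51} & \tfrac23\\ p_{2,1} & \tfrac12 & \tfrac32 & \tfrac23 & 2\\ p_{2,2} & \tfrac32 & 2 & \tfrac12 & \tfrac23\\ p_{2,3} & \tfrac74 & \tfrac76 & \tfrac67 & \tfrac47 \end{array}$$ (so that, for example, the angle of $F_{2,2}$ at $p_{1,1}$ is $2\arctan\frac32$). Such nets exist, and such a net is not isometrically deformable (not flexible), while both of its $3\times 3$-subnets (face columns $1,2,3$ and face columns $2,3,4$) are isometrically deformable (flexible).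
   Context: An $m\times n$ discrete conjugate net is a polyhedral surface in $\mathbb{R}^3$ with planar quadrilateral faces connected in the combinatorics of an $m\times n$ square grid of faces: points $p_{i,j}\in\mathbb{R}^3$, $0\le i\le m$, $0\le j\le n$, such that $p_{i-1,j-1},p_{i-1,j},p_{i,j},p_{i,j-1}$ are, in this cyclic order, the vertices of a planar quadrilateral (the face $F_{i,j}$ in row $i$ and column $j$). An exterior dihedral angle $0$ at an interior edge means that the two faces at this edge are coplanar and lie on different sides of the edge. An isometric deformation of a net is a one-parameter smooth family of discrete conjugate nets in $\mathbb{R}^3$ (same combinatorics, self-intersections allowed), starting from the given net at $t=0$, $t\in(-\varepsilon,\varepsilon)$, in which every face undergoes a rigid motion of space (each face $F$ at time $t$ is the image of the original face under an orientation-preserving isometry $g_F(t)$, smooth in $t$, $g_F(0)=\mathrm{id}$). It is trivial if all faces undergo the same rigid motion. A net is flexible (isometrically deformable) if it admits a non-trivial isometric deformation, and rigid otherwise. *)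

(* Defs.v *)
From HB Require Import structures.
From mathcomp Require Import all_boot all_order all_algebra.
From mathcomp Require Import all_classical all_reals all_analysis.
Import Order.TTheory GRing.Theory Num.Theory.
Import numFieldNormedType.Exports.

Set Implicit Arguments.
Unset Strict Implicit.
Unset Printing Implicit Defensive.

Local Open Scope classical_set_scope.
Local Open Scope ring_scope.

(* Points of R^3 are row vectors.  The library norm `|u| on 'rV[R]_3 is the
   sup norm, so the Euclidean structure is introduced separately. *)

Definition dot (R : realType) (u v : 'rV[R]_3) : R := (u *m v^T) 0 0.

Definition enorm (R : realType) (u : 'rV[R]_3) : R := Num.sqrt (dot u u).

(* Indices are added modulo 3 in 'I_3. *)
Definition cross (R : realType) (u v : 'rV[R]_3) : 'rV[R]_3 :=
  \row_(k < 3) (u 0 (k + 1) * v 0 (k + 2%:R) - u 0 (k + 2%:R) * v 0 (k + 1)).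

Definition coplanar (R : realType) (S : set 'rV[R]_3) : Prop :=
  exists (w : 'rV[R]_3) (c : R), w != 0 /\ forall x, S x -> dot w x = c.

(* For coplanar a, b, x, y, the vectors (b - a) x (x - a) and
   (b - a) x (y - a) are normal to the common plane; they point the same way
   (resp. opposite ways) iff x and y lie strictly on the same side (resp.
   strictly on different sides) of the line ab in that plane. *)
Definition same_side (R : realType) (a b x y : 'rV[R]_3) : Prop :=
  0 < dot (cross (b - a) (x - a)) (cross (b - a) (y - a)).

Definition opposite_sides (R : realType) (a b x y : 'rV[R]_3) : Prop :=
  dot (cross (b - a) (x - a)) (cross (b - a) (y - a)) < 0.

Definition closed_segment (R : realType) (a b : 'rV[R]_3) : set 'rV[R]_3 :=
  [set x | exists2 s : R, 0 <= s <= 1 & x = a + s *: (b - a)].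

(* abcd is a quadrilateral with this cyclic order of vertices: its four sides
   form a simple closed polygon. *)
Definition planar_quadrilateral (R : realType) (a b c d : 'rV[R]_3) : Prop :=
  coplanar [set a; b; c; d] /\
  [/\ uniq [:: a; b; c; d],
      closed_segment a b `&` closed_segment c d = set0,
      closed_segment b c `&` closed_segment d a = set0 &
      [/\ closed_segment a b `&` closed_segment b c = [set b],
          closed_segment b c `&` closed_segment c d = [set c],
          closed_segment c d `&` closed_segment d a = [set d] &
          closed_segment d a `&` closed_segment a b = [set a]]].

(* The line through each side leaves the two other vertices strictly on one
   side. *)
Definition strictly_convex (R : realType) (a b c d : 'rV[R]_3) : Prop :=
  [/\ same_side a b c d, same_side b c d a, same_side c d a b
    & same_side d a b c].

(* The angle at v between the rays vu and vw, in [0, pi]; for a strictly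
   convex quadrilateral with neighbours u, w of the vertex v this is the
   interior angle. *)
Definition angle (R : realType) (u v w : 'rV[R]_3) : R :=
  acos (dot (u - v) (w - v) / (enorm (u - v) * enorm (w - v))).

(* An m x n net is given by p : nat -> nat -> 'rV[R]_3; only the values p i j
   with i <= m and j <= n matter.  The face in row i and column j
   (1 <= i <= m, 1 <= j <= n) has the vertices
   p_{i-1,j-1}, p_{i-1,j}, p_{i,j}, p_{i,j-1}. *)

Definition conjugate_net (R : realType) (m n : nat)
    (p : nat -> nat -> 'rV[R]_3) : Prop :=
  forall i j : nat, (0 < i <= m)%N -> (0 < j <= n)%N ->
    planar_quadrilateral (p i.-1 j.-1) (p i.-1 j) (p i j) (p i j.-1).

Definition strictly_convex_faces (R : realType) (m n : nat)
    (p : nat -> nat -> 'rV[R]_3) : Prop :=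
  forall i j : nat, (0 < i <= m)%N -> (0 < j <= n)%N ->
    strictly_convex (p i.-1 j.-1) (p i.-1 j) (p i j) (p i j.-1).

Definition planar_net (R : realType) (m n : nat)
    (p : nat -> nat -> 'rV[R]_3) : Prop :=
  coplanar [set x | exists i j : nat, [/\ (i <= m)%N, (j <= n)%N & x = p i j]].

(* Two faces share the edge ab; x, y
   (resp. x', y') are the two vertices of the first (resp. second) face that
   are not on this edge. *)
Definition zero_dihedral (R : realType) (a b x y x' y' : 'rV[R]_3) : Prop :=
  coplanar [set a; b; x; y; x'; y'] /\
  [/\ opposite_sides a b x x', opposite_sides a b x y',
      opposite_sides a b y x' & opposite_sides a b y y'].

(* First conjunct: the edge p_{i,j-1} p_{i,j} between the faces (i, j) and
   (i+1, j).  Second conjunct: the edge p_{i-1,j} p_{i,j} between the faces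
   (i, j) and (i, j+1). *)
Definition zero_dihedrals (R : realType) (m n : nat)
    (p : nat -> nat -> 'rV[R]_3) : Prop :=
  (forall i j : nat, (0 < i < m)%N -> (0 < j <= n)%N ->
     zero_dihedral (p i j.-1) (p i j)
       (p i.-1 j.-1) (p i.-1 j) (p i.+1 j.-1) (p i.+1 j)) /\
  (forall i j : nat, (0 < i <= m)%N -> (0 < j < n)%N ->
     zero_dihedral (p i.-1 j) (p i j)
       (p i.-1 j.-1) (p i j.-1) (p i.-1 j.+1) (p i j.+1)).

(* Tangents of the halves of the face angles at the interior vertex p_{i,j},
   in the faces (i+1, j), (i+1, j+1), (i, j), (i, j+1), in this order. *)
Definition half_angle_tangents (R : realType) (p : nat -> nat -> 'rV[R]_3)
    (i j : nat) (ul ur ll lr : R) : Prop :=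
  [/\ tan (angle (p i.+1 j) (p i j) (p i j.-1) / 2) = ul,
      tan (angle (p i.+1 j) (p i j) (p i j.+1) / 2) = ur,
      tan (angle (p i.-1 j) (p i j) (p i j.-1) / 2) = ll &
      tan (angle (p i.-1 j) (p i j) (p i j.+1) / 2) = lr].

Definition smooth_on (R : realType) (V : normedModType R) (e : R)
    (f : R -> V) : Prop :=
  forall (k : nat) (t : R), - e < t < e -> derivable (derive1n k f) t 1.

(* x |-> x *m A + b, with A a rotation matrix, is an orientation-preserving
   isometry of R^3, and every such isometry has this form. *)
Definition rotation (R : realType) (A : 'M[R]_3) : Prop :=
  A *m A^T = 1%:M /\ \det A = 1.

Definition rigid_motion (R : realType) (A : 'M[R]_3) (b x : 'rV[R]_3) :
  'rV[R]_3 := x *m A + b.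

(* q t is the net at time t, and x |-> x *m A i j t + b i j t is the rigid
   motion g_F(t) of the face F in row i and column j. *)
Record isometric_deformation (R : realType) (m n : nat)
    (p : nat -> nat -> 'rV[R]_3) (e : R) (q : R -> nat -> nat -> 'rV[R]_3)
    (A : nat -> nat -> R -> 'M[R]_3) (b : nat -> nat -> R -> 'rV[R]_3) :
    Prop := IsometricDeformation {
  deformation_gt0 : 0 < e;
  deformation_net : forall t : R, - e < t < e -> conjugate_net m n (q t);
  deformation_start : forall i j : nat, (i <= m)%N -> (j <= n)%N ->
    q 0 i j = p i j;
  deformation_smooth : forall i j : nat, (i <= m)%N -> (j <= n)%N ->
    smooth_on e (fun t : R => q t i j);
  motion_smooth : forall i j : nat, (0 < i <= m)%N -> (0 < j <= n)%N ->
    smooth_on e (A i j) /\ smooth_on e (b i j);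
  motion_start : forall i j : nat, (0 < i <= m)%N -> (0 < j <= n)%N ->
    A i j 0 = 1%:M /\ b i j 0 = 0;
  motion_rigid : forall i j : nat, (0 < i <= m)%N -> (0 < j <= n)%N ->
    forall t : R, - e < t < e -> rotation (A i j t);
  motion_face : forall i j : nat, (0 < i <= m)%N -> (0 < j <= n)%N ->
    forall t : R, - e < t < e ->
    [/\ q t i.-1 j.-1 = rigid_motion (A i j t) (b i j t) (p i.-1 j.-1),
        q t i.-1 j = rigid_motion (A i j t) (b i j t) (p i.-1 j),
        q t i j = rigid_motion (A i j t) (b i j t) (p i j) &
        q t i j.-1 = rigid_motion (A i j t) (b i j t) (p i j.-1)]
}.

Definition trivial_deformation (R : realType) (m n : nat) (e : R)
    (A : nat -> nat -> R -> 'M[R]_3) (b : nat -> nat -> R -> 'rV[R]_3) :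
    Prop :=
  forall i j i' j' : nat, (0 < i <= m)%N -> (0 < j <= n)%N ->
    (0 < i' <= m)%N -> (0 < j' <= n)%N ->
    forall t : R, - e < t < e -> A i j t = A i' j' t /\ b i j t = b i' j' t.

Definition flexible (R : realType) (m n : nat) (p : nat -> nat -> 'rV[R]_3) :
    Prop :=
  exists (e : R) (q : R -> nat -> nat -> 'rV[R]_3)
    (A : nat -> nat -> R -> 'M[R]_3) (b : nat -> nat -> R -> 'rV[R]_3),
    isometric_deformation m n p e q A b /\ ~ trivial_deformation m n e A b.

(* The net p with its first k columns of faces removed. *)
Definition drop_columns (R : realType) (k : nat) (p : nat -> nat -> 'rV[R]_3) :
    nat -> nat -> 'rV[R]_3 := fun i j => p i (k + j)%N.

Record prescribed_net (R : realType) (p : nat -> nat -> 'rV[R]_3) : Prop :=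
  PrescribedNet {
  prescribed_conjugate : conjugate_net 3 4 p;
  prescribed_planar : planar_net 3 4 p;
  prescribed_convex : strictly_convex_faces 3 4 p;
  prescribed_dihedral : zero_dihedrals 3 4 p;
  prescribed_11 : half_angle_tangents p 1 1 2 (3 / 2) (2 / 3) (1 / 2);
  prescribed_12 : half_angle_tangents p 1 2 (2 / 3) (7 / 6) (6 / 7) (3 / 2);
  prescribed_13 : half_angle_tangents p 1 3 (3 / 2) (51 / 76) (76 / 51) (2 / 3);
  prescribed_21 : half_angle_tangents p 2 1 (1 / 2) (3 / 2) (2 / 3) 2;
  prescribed_22 : half_angle_tangents p 2 2 (3 / 2) 2 (1 / 2) (2 / 3);
  prescribed_23 : half_angle_tangents p 2 3 (7 / 4) (7 / 6) (6 / 7) (4 / 7)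
}.

(* Main.v *)
(** At a vertex where opposite face angles are supplementary, opposite dihedral
    angles are equal up to sign, and the tangents of the halves of adjacent ones
    have a constant ratio, with two possible values.  Hence all edges of a row
    line and all edges of a column line are folded by one angle.  In the
    3 x 4 net the first and the third column each determine the ratio of the
    half-angle tangents of the two horizontal lines, up to finitely many values,
    and no value is common to both: the horizontal lines are not folded, or
    folded by a half turn, and the latter is excluded by continuity.  Then
    nothing is folded.

    In a 3 x 3 net, rotate the neighbours of the fixed central face about its
    edges by 2 arctan (tau_k t), with tau_k constant.  With a suitable choice of
    modes at the four vertices the product of the ratios around the face is 1,
    so the tau_k exist.  The corner faces close up because the two products of
    quaternions describing their position are equal. *)

Require Import Defs.
From mathcomp Require Import all_boot all_order all_algebra.
From mathcomp Require Import all_classical all_reals all_analysis.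
From mathcomp Require Import ring lra.
Import Order.TTheory GRing.Theory Num.Theory.
Import numFieldNormedType.Exports.

Set Implicit Arguments.
Unset Strict Implicit.
Unset Printing Implicit Defensive.

Local Open Scope classical_set_scope.
Local Open Scope ring_scope.

(** * Euclidean vectors *)

(** Consider, up to sign, the quotient of the half-angle tangents of the folds on the upper and on
    the lower horizontal line. The two modes at each of the two vertices of a column allow it only
    the values 7/2, 49, 1/4 in the first column, 11/21, 22/3, 1/56, 1/4 in the second and 11/21,
    803/105, 1/1525, 73/7625 in the third. The middle column shares 1/4 with the first and 11/21
    with the third, while the first and the third share nothing: this is the source both of the
    flexible subnets and of the rigidity of the whole net. In the rigidity part the ratios are
    squared and written as polynomial identities between cosines of dihedral angles. Then the signs
    of the angles disappear, folds by 0 or by a half turn need no division, and the modes may vary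
    with the time t, since the argument is made at each t separately; continuity enters only to
    exclude the half turn. For the flexible subnets the signs do matter, as the signed ratios have
    to multiply to 1 around the central face. *)

Section Vectors.
Variable R : realType.
Implicit Types (u v w n : 'rV[R]_3) (a b c s t : R) (A B M : 'M[R]_3).

Lemma dotE u v : dot u v = u 0 0 * v 0 0 + u 0 1 * v 0 1 + u 0 2%:R * v 0 2%:R.
Proof.
rewrite /dot mxE !big_ord_recl big_ord0 !mxE addr0 addrA.
by congr (_ + _ + _); congr (u _ _ * v _ _); apply/val_inj.
Qed.

Lemma cross0E u v : cross u v 0 0 = u 0 1 * v 0 2%:R - u 0 2%:R * v 0 1.
Proof. by rewrite mxE !add0r. Qed.

Lemma cross1E u v : cross u v 0 1 = u 0 2%:R * v 0 0 - u 0 0 * v 0 2%:R.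
Proof.
rewrite mxE; congr (u _ _ * v _ _ - u _ _ * v _ _); exact/val_inj.
Qed.

Lemma cross2E u v : cross u v 0 2%:R = u 0 0 * v 0 1 - u 0 1 * v 0 0.
Proof.
rewrite mxE; congr (u _ _ * v _ _ - u _ _ * v _ _); exact/val_inj.
Qed.

Lemma row3P u v :
  u 0 0 = v 0 0 -> u 0 1 = v 0 1 -> u 0 2%:R = v 0 2%:R -> u = v.
Proof.
move=> h0 h1 h2; apply/rowP => -[[|[|[|//]]] k].
- by have -> : Ordinal k = 0 by apply/val_inj.
- by have -> : Ordinal k = 1 by apply/val_inj.
- by have -> : Ordinal k = 2%:R by apply/val_inj.
Qed.

Lemma addv_E u v (i : 'I_1) k : (u + v) i k = u i k + v i k.
Proof. by rewrite mxE. Qed.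
Lemma oppv_E u (i : 'I_1) k : (- u) i k = - u i k.
Proof. by rewrite mxE. Qed.
Lemma scalev_E a u (i : 'I_1) k : (a *: u) i k = a * u i k.
Proof. by rewrite mxE. Qed.
Lemma zerov_E (i : 'I_1) k : (0 : 'rV[R]_3) i k = 0.
Proof. by rewrite mxE. Qed.

Definition vecE :=
  (dotE, cross0E, cross1E, cross2E, addv_E, oppv_E, scalev_E, zerov_E).

End Vectors.

Ltac vec_ring := rewrite ?vecE; ring.
Ltac vec_eq := apply: row3P; vec_ring.

Section VectorTheory.
Variable R : realType.
Implicit Types (u v w n e : 'rV[R]_3) (a b c s t : R) (A B M : 'M[R]_3).

Lemma dotC u v : dot u v = dot v u. Proof. vec_ring. Qed.
Lemma dotDl u v w : dot (u + v) w = dot u w + dot v w. Proof. vec_ring. Qed.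
Lemma dotDr u v w : dot u (v + w) = dot u v + dot u w. Proof. vec_ring. Qed.
Lemma dotNl u v : dot (- u) v = - dot u v. Proof. vec_ring. Qed.
Lemma dotNr u v : dot u (- v) = - dot u v. Proof. vec_ring. Qed.
Lemma dotZl a u v : dot (a *: u) v = a * dot u v. Proof. vec_ring. Qed.
Lemma dotZr a u v : dot u (a *: v) = a * dot u v. Proof. vec_ring. Qed.
Lemma dotBl u v w : dot (u - v) w = dot u w - dot v w. Proof. vec_ring. Qed.
Lemma dotBr u v w : dot u (v - w) = dot u v - dot u w. Proof. vec_ring. Qed.
Definition dot_lin := (dotDl, dotDr, dotNl, dotNr, dotZl, dotZr).

Lemma crossC u v : cross u v = - cross v u. Proof. vec_eq. Qed.
Lemma crossDr u v w : cross u (v + w) = cross u v + cross u w. Proof. vec_eq.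
  Qed.
Lemma crossDl u v w : cross (u + v) w = cross u w + cross v w. Proof. vec_eq.
  Qed.
Lemma crossNr u v : cross u (- v) = - cross u v. Proof. vec_eq. Qed.
Lemma crossNl u v : cross (- u) v = - cross u v. Proof. vec_eq. Qed.
Lemma crossZr a u v : cross u (a *: v) = a *: cross u v. Proof. vec_eq. Qed.
Lemma crossZl a u v : cross (a *: u) v = a *: cross u v. Proof. vec_eq. Qed.
Lemma crossvv u : cross u u = 0. Proof. vec_eq. Qed.
Definition cross_lin := (crossDl, crossDr, crossNl, crossNr, crossZl, crossZr).

Lemma cross_cross u v w : cross u (cross v w) = dot u w *: v - dot u v *: w.
Proof. vec_eq. Qed.
Lemma dot_cross_cross u v w z :
  dot (cross u v) (cross w z) = dot u w * dot v z - dot u z * dot v w.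
Proof. vec_ring. Qed.
Lemma dot_crossl u v : dot u (cross u v) = 0. Proof. vec_ring. Qed.
Lemma dot_crossr u v : dot v (cross u v) = 0. Proof. vec_ring. Qed.

Lemma dot_ge0 u : 0 <= dot u u.
Proof. by rewrite dotE -!expr2 !addr_ge0 // sqr_ge0. Qed.

Lemma dot_eq0 u : (dot u u == 0) = (u == 0).
Proof.
apply/idP/eqP => [|->]; last by rewrite !vecE !mulr0 !addr0.
rewrite dotE -!expr2 !paddr_eq0 ?addr_ge0 ?sqr_ge0 // !sqrf_eq0.
by move=> /andP[/andP[/eqP h0 /eqP h1] /eqP h2]; apply: row3P; rewrite zerov_E.
Qed.

Lemma dot_gt0 u : (0 < dot u u) = (u != 0).
Proof. by rewrite lt_neqAle dot_ge0 andbT eq_sym dot_eq0. Qed.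

Lemma dot_inj u v : (forall w, dot u w = dot v w) -> u = v.
Proof.
move=> h; apply/eqP; rewrite -subr_eq0 -dot_eq0 dotBl.
by rewrite (h (u - v)) subrr.
Qed.

Lemma dot_mulmxr u v A : dot u (v *m A) = dot (u *m A^T) v.
Proof. by rewrite /dot trmx_mul mulmxA. Qed.

Lemma det3E A : \det A =
  A 0 0 * (A 1 1 * A 2%:R 2%:R - A 1 2%:R * A 2%:R 1)
  - A 0 1 * (A 1 0 * A 2%:R 2%:R - A 1 2%:R * A 2%:R 0)
  + A 0 2%:R * (A 1 0 * A 2%:R 1 - A 1 1 * A 2%:R 0).
Proof.
pose f (i j : nat) := A (inord i) (inord j).
have E i j : A i j = f i j by rewrite /f !inord_val.
rewrite (expand_det_row _ 0) !big_ord_recl big_ord0 /cofactor.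
rewrite !(expand_det_row _ 0) !big_ord_recl !big_ord0 /cofactor !det_mx11 !mxE.
rewrite !E /= /bump /= !addn0 ?add0n ?addn1 ?modn_small //.
ring.
Qed.

End VectorTheory.

(** * Rotations *)

Section Rotations.
Variable R : realType.
Implicit Types (u v w n e : 'rV[R]_3) (a b c s t : R) (A B M : 'M[R]_3).

Lemma mulmx_row3E u A k :
  (u *m A) 0 k = u 0 0 * A 0 k + u 0 1 * A 1 k + u 0 2%:R * A 2%:R k.
Proof.
rewrite mxE !big_ord_recl big_ord0 addr0 addrA.
by congr (_ + _ + _); congr (u _ _ * A _ _); apply/val_inj.
Qed.

Lemma triple_mulmx u v w A :
  dot (cross (u *m A) (v *m A)) (w *m A) = \det A * dot (cross u v) w.
Proof. by rewrite !vecE !mulmx_row3E det3E; ring. Qed.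

Lemma rotation1 : rotation (1%:M : 'M[R]_3).
Proof. by split; rewrite ?trmx1 ?mulmx1 ?det1. Qed.

Lemma rotationM A B : rotation A -> rotation B -> rotation (A *m B).
Proof.
move=> [hA dA] [hB dB]; split; last by rewrite det_mulmx dA dB mulr1.
by rewrite trmx_mul mulmxA -(mulmxA A) hB mulmx1.
Qed.

Lemma rotation_dot A u v : rotation A -> dot (u *m A) (v *m A) = dot u v.
Proof. by move=> [hA _]; rewrite dot_mulmxr -mulmxA hA mulmx1. Qed.

(** The triple product is multiplied by the determinant, which is 1; testing against every [w] turns
    this into an identity of vectors. *)
Lemma rotation_cross A u v :
  rotation A -> cross (u *m A) (v *m A) = cross u v *m A.
Proof.
move=> rA; apply: dot_inj => w.
have [hA dA] := rA.
have -> : w = (w *m A^T) *m A by rewrite -mulmxA (mulmx1C hA) mulmx1.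
by rewrite triple_mulmx dA mul1r rotation_dot.
Qed.

Lemma rotation_inj A : rotation A -> injective (fun u => u *m A).
Proof.
move=> [hA _] u v /= /(congr1 (mulmx^~ A^T)).
by rewrite -!mulmxA hA !mulmx1.
Qed.

(* Two faces meeting along a common edge e, with unit normal n in the flat
   position: c is the cosine of their dihedral angle. *)
Lemma fold_dot n e a b a' b' A B :
  dot n n = 1 -> dot e e = 1 -> dot n e = 0 ->
  rotation A -> rotation B -> e *m A = e *m B ->
  dot ((a *: e + b *: cross n e) *m A) ((a' *: e + b' *: cross n e) *m B) =
  a * a' + b * b' * dot (n *m A) (n *m B).
Proof.
move=> hn he hne rA rB eAB.
have eBB : dot (e *m B) (e *m B) = 1 by rewrite rotation_dot.
have neA : dot (n *m A) (e *m B) = 0 by rewrite -eAB rotation_dot.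
have neB : dot (n *m B) (e *m B) = 0 by rewrite rotation_dot.
rewrite !mulmxDl -!scalemxAl -!rotation_cross // eAB.
rewrite !dot_lin dot_cross_cross !(dotC (e *m B)) eBB neA neB.
by rewrite !(dotC (cross _ (e *m B))) !dot_crossr; ring.
Qed.

Lemma frame_dec n e v : dot n n = 1 -> dot e e = 1 -> dot n e = 0 ->
  v = dot v e *: e + dot v n *: n + dot v (cross n e) *: cross n e.
Proof.
move=> hn he hne; set f := cross n e; set r := RHS.
have hf : dot f f = 1 by rewrite dot_cross_cross hn he hne (dotC e) hne; ring.
have hnf : dot n f = 0 by rewrite dot_crossl.
have hef : dot e f = 0 by rewrite dot_crossr.
have re : dot (v - r) e = 0.
  by rewrite !dot_lin he hne (dotC f) hef; ring.
have rn : dot (v - r) n = 0.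
  by rewrite !dot_lin hn (dotC e) hne (dotC f) hnf; ring.
have rf : dot (v - r) f = 0 by rewrite !dot_lin hf hnf hef; ring.
apply/eqP; rewrite -subr_eq0 -dot_eq0.
(* [v - r] is orthogonal to [e] and [n], so its cross product with [f] vanishes; as it is also
   orthogonal to the unit vector [f], its length is 0. *)
have := dot_cross_cross (v - r) f (v - r) f.
rewrite cross_cross re rn rf !scale0r subr0 hf mulr1 mul0r subr0 => <-.
by rewrite !vecE !mul0r !addr0.
Qed.

Lemma fold_trivial n e A B :
  dot n n = 1 -> dot e e = 1 -> dot n e = 0 -> rotation A -> rotation B ->
  e *m A = e *m B -> dot (n *m A) (n *m B) = 1 -> A = B.
Proof.
move=> hn he hne rA rB eAB c1.
have nAB : n *m A = n *m B.
  apply/eqP; rewrite -subr_eq0 -dot_eq0 !dot_lin !rotation_dot // hn.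
  by rewrite (dotC (n *m B)) c1; apply/eqP; ring.
have fAB : cross n e *m A = cross n e *m B.
  by rewrite -!rotation_cross // eAB nAB.
apply/row_matrixP => i; rewrite !rowE (frame_dec (delta_mx 0 i) hn he hne).
by rewrite !mulmxDl -!scalemxAl eAB nAB fAB.
Qed.

End Rotations.

(** * Flat vertices *)

(* cos and sin of 2 arctan x. *)
Definition cos2 (R : realType) (x : R) : R := (1 - x ^+ 2) / (1 + x ^+ 2).
Definition sin2 (R : realType) (x : R) : R := 2 * x / (1 + x ^+ 2).

(* The directions of the four edges at a flat vertex, in the cyclic order
   f1, e1, e2, f2 with respect to the normal n; the half-angle tangents of the
   angles between consecutive ones are y, x, y^-1 (and x^-1 between f2 and
   f1). *)
Definition flat_corner (R : realType) (n : 'rV[R]_3) (x y : R)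
    (e1 e2 f1 f2 : 'rV[R]_3) : Prop :=
  [/\ dot n n = 1, dot e1 e1 = 1, dot n e1 = 0 &
   [/\ e2 = cos2 x *: e1 + sin2 x *: cross n e1,
       f1 = cos2 y *: e1 - sin2 y *: cross n e1 &
       f2 = - cos2 y *: e2 + sin2 y *: cross n e2]].

Section Corner.
Variable R : realType.
Implicit Types (u v w n e : 'rV[R]_3) (a b c s t x y : R) (A B M : 'M[R]_3).

Lemma sqr1D_neq0 x : 1 + x ^+ 2 != 0.
Proof. by rewrite gt_eqF // ltr_pwDl // sqr_ge0. Qed.

Lemma cos2_sin2 x : cos2 x ^+ 2 + sin2 x ^+ 2 = 1.
Proof. by rewrite /cos2 /sin2; field; exact: sqr1D_neq0. Qed.

Lemma cos2V x : x != 0 -> cos2 x^-1 = - cos2 x.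
Proof.
by move=> x0; rewrite /cos2; field; rewrite x0 ?sqr1D_neq0.
Qed.

Lemma sin2V x : x != 0 -> sin2 x^-1 = sin2 x.
Proof.
by move=> x0; rewrite /sin2; field; rewrite x0 ?sqr1D_neq0.
Qed.

Lemma sin2_gt0 x : 0 < x -> 0 < sin2 x.
Proof. by move=> x0; rewrite divr_gt0 ?mulr_gt0 // ltr_pwDl // sqr_ge0. Qed.

Lemma crossK n e : dot n n = 1 -> dot n e = 0 -> cross n (cross n e) = - e.
Proof. by move=> hn hne; rewrite cross_cross hn hne scale0r sub0r scale1r. Qed.

Lemma turn_unit n e a b :
  dot n n = 1 -> dot e e = 1 -> dot n e = 0 -> a ^+ 2 + b ^+ 2 = 1 ->
  let v := a *: e + b *: cross n e in
  [/\ dot v v = 1, dot n v = 0 & cross n v = a *: cross n e - b *: e].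
Proof.
move=> hn he hne hab v; have hf : dot (cross n e) (cross n e) = 1.
  by rewrite dot_cross_cross hn he hne (dotC e) hne; ring.
split.
- by rewrite -[RHS]hab /v !dot_lin hf he (dotC (cross n e)) dot_crossr; ring.
- by rewrite /v !dot_lin hne dot_crossl; ring.
- by rewrite /v crossDr !crossZr crossK // scalerN.
Qed.

(** The same vertex read from the next face: the cyclic order f1, e1, e2, f2 becomes e1, e2, f2, f1.
    A fact about one edge or face of the vertex can thus be carried to the others. *)
Lemma corner_shift n x y e1 e2 f1 f2 : y != 0 ->
  flat_corner n x y e1 e2 f1 f2 -> flat_corner n y^-1 x e2 f2 e1 f1.
Proof.
move=> y0 [hn he hne [E2 F1 F2]].
have [] := turn_unit hn he hne (cos2_sin2 x); rewrite -E2 => h2 hn2 J2.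
have [] := turn_unit hn h2 hn2 (_ : (- cos2 y) ^+ 2 + sin2 y ^+ 2 = 1).
  by rewrite sqrrN cos2_sin2.
rewrite -F2 => h3 hn3 J3.
split => //; rewrite cos2V // sin2V //; split=> //.
  by rewrite J2 E2 -[LHS]scale1r -(cos2_sin2 x); vec_eq.
rewrite J3 F1 F2 J2 E2.
suff -> : cos2 y *: e1 - sin2 y *: cross n e1 = (cos2 x ^+ 2 + sin2 x ^+ 2) *:
  (cos2 y *: e1 - sin2 y *: cross n e1) by set f := cross n e1; vec_eq.
by rewrite cos2_sin2 scale1r.
Qed.

Section FourFaces.
Variables (n e1 e2 f1 f2 : 'rV[R]_3) (x y : R) (A B1 B2 D : 'M[R]_3).
Hypotheses (x0 : 0 < x) (y0 : 0 < y).
Hypothesis corner : flat_corner n x y e1 e2 f1 f2.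
Hypotheses (rA : rotation A) (rB1 : rotation B1) (rB2 : rotation B2)
  (rD : rotation D).
Hypotheses (e1A : e1 *m A = e1 *m B1) (e2A : e2 *m A = e2 *m B2)
  (f1D : f1 *m B1 = f1 *m D) (f2D : f2 *m B2 = f2 *m D).

Let c1 := dot (n *m A) (n *m B1).
Let c2 := dot (n *m A) (n *m B2).

(** The inner product of the images of [e1] and [f2] can be computed across [e2] and across [f1].
    Since opposite angles are supplementary, both computations give - cos2 x cos2 y - sin2 x sin2 y
    c, with c the cosine of the fold at [e2], respectively at [f1]. *)
Lemma corner_opposite2 : dot (n *m B1) (n *m D) = c2.
Proof.
have x1 := lt0r_neq0 x0; have y1 := lt0r_neq0 y0.
have [hn he1 hne1 [E2 F1 F2]] := corner.
have k1 := corner_shift y1 corner.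
have k2 := corner_shift x1 k1.
have k3 : flat_corner n y x^-1 f1 e1 f2 e2.
  by rewrite -[y in flat_corner _ y]invrK; apply: corner_shift; rewrite
    ?invr_neq0.
have [_ he2 hne2 [_ E1 _]] := k1.
have [_ hf1 hnf1 [E1' F2' _]] := k3.
have := fold_dot (cos2 x) (- sin2 x) (- cos2 y) (sin2 y) hn he2 hne2 rA rB2 e2A.
rewrite scaleNr -E1 -F2 e1A f2D -/c2.
have := fold_dot (cos2 y) (sin2 y) (cos2 x^-1) (- sin2 x^-1) hn hf1 hnf1
  rB1 rD f1D.
rewrite scaleNr -E1' -F2' => ->.
rewrite cos2V // sin2V // !mulrN !mulNr => /eqP.
rewrite [cos2 y * _]mulrC (inj_eq (addrI _)) eqr_opp.
rewrite [sin2 y * _]mulrC => /eqP/mulfI; apply.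
by rewrite mulf_neq0 // lt0r_neq0 // sin2_gt0.
Qed.

Let X := (1 - c1) * (1 + c2).
Let Y := (1 + c1) * (1 - c2).

(** The images of [f1] and [f2] both lie in the face [D], so their inner product keeps its flat
    value. In terms of the cosines and sines of the folds at [e1] and [e2] this equation is linear
    in the product of the sines; squaring eliminates them, and the polynomial left over splits into
    two factors, one for each mode. X / Y is the quotient of the squared half-angle tangents of the
    two folds. *)
Lemma corner_relation :
  ((x - y) ^+ 2 * X - (x + y) ^+ 2 * Y) *
  ((1 + x * y) ^+ 2 * X - (1 - x * y) ^+ 2 * Y) = 0.
Proof.
have [hn he1 hne1 [E2 F1 F2]] := corner.
have [_ he2 hne2 [_ _ _]] := corner_shift (lt0r_neq0 y0) corner.
pose N := n *m A; pose E := e1 *m A; pose K := cross N E.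
have hN : dot N N = 1 by rewrite rotation_dot.
have hE : dot E E = 1 by rewrite rotation_dot.
have hNE : dot N E = 0 by rewrite rotation_dot.
have hK : dot K K = 1 by rewrite dot_cross_cross hN hE hNE (dotC E) hNE; ring.
have hNK : dot N K = 0 by rewrite dot_crossl.
have hEK : dot E K = 0 by rewrite dot_crossr.
have hCS := cos2_sin2 x.
have [] := turn_unit hN hE hNE hCS.
set E' := _ + _ => hE' hNE' JE'.
have eE' : e2 *m A = E'.
  by rewrite E2 mulmxDl -!scalemxAl -rotation_cross.
have [s1 hs1 N1] : exists2 s1, s1 ^+ 2 = 1 - c1 ^+ 2 & n *m B1 = c1 *: N + s1
  *: K.
  have := frame_dec (n *m B1) hN hE hNE.
  rewrite [dot _ E](_ : _ = 0); last by rewrite /E e1A rotation_dot.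
  rewrite scale0r add0r (dotC _ N) -/K -/c1 => dec; exists (dot (n *m B1) K)
    => //.
  have : dot (n *m B1) (n *m B1) = 1 by rewrite rotation_dot.
  by rewrite {1 2}dec !dot_lin hN hK hNK (dotC K) hNK => <-; ring.
have [s2 hs2 N2] : exists2 s2, s2 ^+ 2 = 1 - c2 ^+ 2 &
    n *m B2 = c2 *: N + s2 *: cross N E'.
  have hK' : dot (cross N E') (cross N E') = 1.
    by rewrite dot_cross_cross hN hE' hNE' (dotC E') hNE'; ring.
  have := frame_dec (n *m B2) hN hE' hNE'.
  rewrite [dot _ E'](_ : _ = 0); last by rewrite -eE' e2A rotation_dot.
  rewrite scale0r add0r (dotC _ N) -/c2 => dec.
  exists (dot (n *m B2) (cross N E')) => //.
  have : dot (n *m B2) (n *m B2) = 1 by rewrite rotation_dot.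
  by rewrite {1 2}dec !dot_lin hN hK' dot_crossl (dotC (cross N E') N)
    dot_crossl => <-; ring.
have hF : dot (f1 *m B1) (f2 *m B2) = dot f1 f2.
  by rewrite f1D f2D rotation_dot.
have G1 : f1 *m B1 = cos2 y *: E - sin2 y *: (c1 *: K - s1 *: N).
  rewrite F1 mulmxBl -!scalemxAl -rotation_cross // N1 -e1A -/E.
  congr (_ - _ *: _); rewrite crossDl !crossZl -/K; congr (_ + _).
  by rewrite crossC cross_cross hE (dotC E) hNE scale1r scale0r subr0 scalerN.
have G2 : f2 *m B2 = - cos2 y *: E' + sin2 y *: (c2 *: cross N E' - s2 *: N).
  rewrite F2 mulmxDl -!scalemxAl -rotation_cross // N2 -e2A eE'.
  congr (_ + _ *: _); rewrite crossDl !crossZl; congr (_ + _).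
  by rewrite crossC cross_cross hE' (dotC E') hNE' scale1r scale0r subr0
    scalerN.
have hf : dot f1 f2 = - cos2 x.
  have [_ _ J2] := turn_unit hn he1 hne1 hCS.
  rewrite F1 F2 E2 J2 !dot_lin he1 dot_cross_cross hn he1 hne1 (dotC e1 n) hne1.
  rewrite dot_crossr (dotC (cross n e1) e1) dot_crossr.
  have := congr1 ( *%R (cos2 x)) (cos2_sin2 y); lra.
have sy := sin2_gt0 y0.
have key : sin2 y * s1 * s2 =
  sin2 y * cos2 x * (1 - c1 * c2) + cos2 y * sin2 x * (c1 - c2).
  apply: (mulfI (lt0r_neq0 sy)).
  move: hF; rewrite hf G1 G2 JE' /E' !dot_lin hE hK hN hEK (dotC K E) hEK.
  rewrite hNE hNK (dotC E N) hNE (dotC K N) hNK.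
  have := congr1 ( *%R (cos2 x)) (cos2_sin2 y); lra.
have -> : ((x - y) ^+ 2 * X - (x + y) ^+ 2 * Y) *
    ((1 + x * y) ^+ 2 * X - (1 - x * y) ^+ 2 * Y) =
    ((1 + x ^+ 2) * (1 + y ^+ 2)) ^+ 2 *
    ((sin2 y * cos2 x * (1 - c1 * c2) + cos2 y * sin2 x * (c1 - c2)) ^+ 2 -
     sin2 y ^+ 2 * (1 - c1 ^+ 2) * (1 - c2 ^+ 2)).
  by rewrite /X /Y /sin2 /cos2; field; rewrite !sqr1D_neq0.
by rewrite -key -hs1 -hs2 !exprMn subrr mulr0.
Qed.

End FourFaces.
Lemma corner_rigidity n e1 e2 f1 f2 x y A B1 B2 D : 0 < x -> 0 < y ->
  flat_corner n x y e1 e2 f1 f2 ->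
  rotation A -> rotation B1 -> rotation B2 -> rotation D ->
  e1 *m A = e1 *m B1 -> e2 *m A = e2 *m B2 ->
  f1 *m B1 = f1 *m D -> f2 *m B2 = f2 *m D ->
  let c1 := dot (n *m A) (n *m B1) in
  let c2 := dot (n *m A) (n *m B2) in
  let X := (1 - c1) * (1 + c2) in
  let Y := (1 + c1) * (1 - c2) in
  [/\ dot (n *m B2) (n *m D) = c1, dot (n *m B1) (n *m D) = c2 &
   ((x - y) ^+ 2 * X - (x + y) ^+ 2 * Y) *
   ((1 + x * y) ^+ 2 * X - (1 - x * y) ^+ 2 * Y) = 0].
Proof.
move=> x0 y0 hc rA rB1 rB2 rD eA eB fA fB c1 c2 X Y; split.
- have hc' := corner_shift (lt0r_neq0 y0) hc.
  have y1 : 0 < y^-1 by rewrite invr_gt0.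
  rewrite /c1 (corner_opposite2 y1 x0 hc' rB2 rA rD rB1) //.
- exact: (corner_opposite2 x0 y0 hc).
- exact: (corner_relation y0 hc rA rB1 rB2 rD).
Qed.

End Corner.

(** * Orientation of planar nets *)

Section PlanarNets.
Variable R : realType.
Implicit Types (u v w n e o : 'rV[R]_3) (a b c s t x y : R).

Lemma enorm_gt0 u : (0 < enorm u) = (u != 0).
Proof. by rewrite /enorm sqrtr_gt0 dot_gt0. Qed.

Lemma enorm_sqr u : enorm u ^+ 2 = dot u u.
Proof. by rewrite /enorm sqr_sqrtr // dot_ge0. Qed.

Definition unit_vec u := (enorm u)^-1 *: u.

Lemma unit_vecK u : u != 0 -> dot (unit_vec u) (unit_vec u) = 1.
Proof.
rewrite -enorm_gt0 => u0; rewrite /unit_vec dotZl dotZr -enorm_sqr.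
by field; rewrite gt_eqF.
Qed.

Lemma cos2_tan_half x c : -1 <= c <= 1 -> 0 < x -> tan (acos c / 2) = x ->
  c = cos2 x.
Proof.
move=> hc x0; set h := acos c / 2 => hx.
(* [tan] is a quotient with the convention that division by 0 gives 0, so a positive tangent
   excludes a zero cosine. *)
have h0 : cos h != 0.
  by apply: contraTneq x0 => h0; rewrite -hx /tan h0 invr0 mulr0 ltxx.
rewrite -(acosK hc) (splitr (acos c)) -/h cosD -hx /cos2 /tan.
rewrite expr_div_n -!expr2.
have -> : cos h ^+ 2 - sin h ^+ 2 =
  (cos h ^+ 2 - sin h ^+ 2) / (cos h ^+ 2 + sin h ^+ 2).
  by rewrite cos2Dsin2 divr1.
have h1 : cos h ^+ 2 + sin h ^+ 2 != 0 by rewrite cos2Dsin2 oner_neq0.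
by field; rewrite h0 h1.
Qed.

Lemma tan_half_acos x : 0 < x -> tan (acos (cos2 x) / 2) = x.
Proof.
move=> x0; have -> : cos2 x = cos (atan x *+ 2).
  rewrite cos_mulr2n cos_atan exprVn sqr_sqrtr ?addr_ge0 ?sqr_ge0 //.
  by rewrite mulr2n /cos2; field; exact: sqr1D_neq0.
have ha := atan_gtNpi2 x; have hb := atan_ltpi2 x.
have hc : 0 < atan x by rewrite -(atan0 R); exact: lt_atan.
rewrite cosK; last by rewrite in_itv /= -(mulr_natr (atan x) 2); apply/andP;
  split; lra.
by rewrite -(mulr_natr (atan x) 2) mulfK ?pnatr_eq0 // atanK.
Qed.

(** The unsigned angle determines the direction of [v] only up to reflection in [u]; the positive
    orientation selects the sign of the sine. *)
Lemma turn_dir n u v x : dot n n = 1 -> dot n u = 0 -> dot n v = 0 ->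
  0 < dot n (cross u v) -> 0 < x ->
  tan (acos (dot u v / (enorm u * enorm v)) / 2) = x ->
  unit_vec v = cos2 x *: unit_vec u + sin2 x *: cross n (unit_vec u).
Proof.
move=> hn hu hv huv x0.
have u0 : u != 0.
  by apply: contraTneq huv => ->; rewrite (_ : dot _ _ = 0) ?ltxx //; vec_ring.
have v0 : v != 0.
  by apply: contraTneq huv => ->; rewrite (_ : dot _ _ = 0) ?ltxx //; vec_ring.
have eu : 0 < enorm u by rewrite enorm_gt0.
have ev : 0 < enorm v by rewrite enorm_gt0.
set U := unit_vec u; set V := unit_vec v.
have hU : dot U U = 1 by apply: unit_vecK.
have hV : dot V V = 1 by apply: unit_vecK.
have hnU : dot n U = 0 by rewrite dotZr hu mulr0.
have hnV : dot n V = 0 by rewrite dotZr hv mulr0.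
have -> : dot u v / (enorm u * enorm v) = dot V U.
  by rewrite /U /V dotZl dotZr (dotC v); field; rewrite !gt_eqF.
set F := cross n U.
have hF : dot F F = 1 by rewrite dot_cross_cross hn hU hnU (dotC U) hnU; ring.
have dec := frame_dec V hn hU hnU.
rewrite (dotC V n) hnV scale0r addr0 -/F in dec.
have hd : 0 < dot V F.
  rewrite (_ : dot V F = (enorm u)^-1 * (enorm v)^-1 * dot n (cross u v)).
    by rewrite !mulr_gt0 ?invr_gt0.
  by rewrite /V /F /U /unit_vec crossZr dotZr dotZl; vec_ring.
have hUF : dot U F = 0 by exact: dot_crossr.
clearbody F U V.
have hcd : dot V U ^+ 2 + dot V F ^+ 2 = 1.
  by rewrite -[RHS]hV {3 4}dec !dot_lin hU hF (dotC F) hUF; ring.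
have hb : -1 <= dot V U <= 1.
  by rewrite -ler_norml -(@ler_pXn2r _ 2) ?nnegrE // expr1n real_normK
    ?num_real // -hcd lerDl sqr_ge0.
move=> /(cos2_tan_half hb x0) hc.
suff -> : sin2 x = dot V F by rewrite -hc -dec.
have hs := sin2_gt0 x0.
apply/eqP; rewrite -(@eqrXn2 _ 2) ?ltW //; apply/eqP.
by move: (cos2_sin2 x); rewrite -hcd -hc => /addrI.
Qed.

(* Twice the signed area of the triangle abc, with respect to the normal n. *)
Definition turn (n a b c : 'rV[R]_3) : R := dot n (cross (b - a) (c - a)).

Lemma turn_rot n (a b c : 'rV[R]_3) : turn n b c a = turn n a b c.
Proof. by rewrite /turn; vec_ring. Qed.

Lemma turn_swap n (a b c : 'rV[R]_3) : turn n a c b = - turn n a b c.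
Proof. by rewrite /turn crossC dotNr. Qed.

Lemma cross_normal n u v : dot n n = 1 -> dot n u = 0 -> dot n v = 0 ->
  cross u v = dot n (cross u v) *: n.
Proof.
move=> hn hu hv.
have : cross n (cross n (cross u v)) = 0.
  by rewrite [cross n (cross u v)]cross_cross hv hu !scale0r subr0; vec_eq.
by rewrite cross_cross hn scale1r => /eqP; rewrite subr_eq0 => /eqP/esym.
Qed.

Lemma dot_turns n (a b x y : 'rV[R]_3) : dot n n = 1 ->
  dot n (b - a) = 0 -> dot n (x - a) = 0 -> dot n (y - a) = 0 ->
  dot (cross (b - a) (x - a)) (cross (b - a) (y - a)) =
  turn n a b x * turn n a b y.
Proof.
move=> hn hb hx hy; rewrite (cross_normal hn hb hx) (cross_normal hn hb hy).
by rewrite dotZl dotZr hn mulr1.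
Qed.

(** Stated with products because the sign of the normal [n] has not been chosen yet. *)
Lemma convex_turns n (a b c d : 'rV[R]_3) : dot n n = 1 ->
  dot n (b - a) = 0 -> dot n (c - a) = 0 -> dot n (d - a) = 0 ->
  strictly_convex a b c d ->
  [/\ 0 < turn n a b d * turn n b c a, 0 < turn n a b d * turn n c d b,
      0 < turn n a b d * turn n d a c & turn n a b d != 0].
Proof.
move=> hn hb hc hd [].
have sub (x y : 'rV[R]_3) : dot n (x - a) = 0 -> dot n (y - a) = 0 -> dot n (x
  - y) = 0.
  by move=> hx hy; rewrite (_ : x - y = (x - a) - (y - a));
    [rewrite dotBr hx hy subrr | vec_eq].
have haa : dot n (a - a) = 0 by rewrite subrr; vec_ring.
rewrite /same_side !(dot_turns hn); try by apply: sub.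
have -> : turn n b c a = turn n a b c by exact: turn_rot.
have -> : turn n c d b = turn n b c d by exact: turn_rot.
have -> : turn n d a b = turn n a b d by exact/esym/turn_rot.
have -> : turn n d a c = turn n c d a by exact: turn_rot.
set p := turn n a b c; set q := turn n a b d.
set r := turn n b c d; set s := turn n c d a.
move=> h1 h2 h3 h4.
have sg (x y z : R) : 0 < x * y -> 0 < y * z -> 0 < x * z.
  rewrite -!(mulrC y) => h h'; have := mulr_gt0 h h'.
  have -> : y * x * (y * z) = y ^+ 2 * (x * z) by ring.
  rewrite pmulr_rgt0 // lt_neqAle sqr_ge0 eq_sym sqrf_eq0 andbT.
  by apply: contraTneq h => ->; rewrite mul0r ltxx.
have hqp : 0 < q * p by rewrite mulrC.
have hpr : 0 < p * r by rewrite mulrC.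
have hqr := sg _ _ _ hqp hpr.
split => //.
by apply: contraTneq hqp => ->; rewrite mul0r ltxx.
Qed.

Definition positive_face (n a b c d : 'rV[R]_3) : Prop :=
  [/\ 0 < turn n a b d, 0 < turn n b c a, 0 < turn n c d b
    & 0 < turn n d a c].

(* Across an edge with exterior dihedral angle 0 the orientation is kept. *)
Lemma planar_net_orientation (m k : nat) (p : nat -> nat -> 'rV[R]_3) :
  (0 < m)%N -> (0 < k)%N ->
  planar_net m k p -> strictly_convex_faces m k p -> zero_dihedrals m k p ->
  exists n : 'rV[R]_3, [/\ dot n n = 1,
    forall i j i' j', (i <= m)%N -> (j <= k)%N -> (i' <= m)%N -> (j' <= k)%N ->
      dot n (p i j - p i' j') = 0 &
    forall i j, (i < m)%N -> (j < k)%N ->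
      positive_face n (p i j) (p i j.+1) (p i.+1 j.+1) (p i.+1 j)].
Proof.
move=> m0 k0 [w [c [w0 hw]]] convp [zh zv].
pose n := unit_vec w; have hn : dot n n = 1 by apply: unit_vecK.
have hp i j i' j' : (i <= m)%N -> (j <= k)%N -> (i' <= m)%N -> (j' <= k)%N ->
    dot n (p i j - p i' j') = 0.
  move=> hi hj hi' hj'; rewrite dotZl dotBr !hw ?subrr ?mulr0 //.
    by exists i', j'.
  by exists i, j.
pose s v i j := turn v (p i j) (p i j.+1) (p i.+1 j).
(* The normal [v] is arbitrary, so that this serves for whichever of [n] and [- n] makes the first
   face positive. *)
have pos v : dot v v = 1 -> (forall i j i' j', (i <= m)%N -> (j <= k)%N ->
    (i' <= m)%N -> (j' <= k)%N -> dot v (p i j - p i' j') = 0) ->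
    0 < s v 0%N 0%N -> forall i j, (i < m)%N -> (j < k)%N ->
    positive_face v (p i j) (p i j.+1) (p i.+1 j.+1) (p i.+1 j).
  move=> hv hvp s0.
  have face i j : (i < m)%N -> (j < k)%N -> 0 < s v i j ->
      positive_face v (p i j) (p i j.+1) (p i.+1 j.+1) (p i.+1 j).
    move=> hi hj hs.
    have := convp i.+1 j.+1 hi hj => /(convex_turns hv).
    rewrite !hvp ?(ltnW hi) ?(ltnW hj) // => /(_ erefl erefl erefl).
    by rewrite -/(s v i j) !pmulr_rgt0 // => -[h1 h2 h3 _]; split.
  have right i j : (i < m)%N -> (j.+1 < k)%N -> 0 < s v i j -> 0 < s v i j.+1.
    move=> hi hj hs; have [_ h _ _] := face _ _ hi (ltnW hj) hs.
    have [_ [+ _ _ _]] := zv i.+1 j.+1 hi hj.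
    rewrite /opposite_sides /= (dot_turns hv) ?hvp ?(ltnW hi) ?(ltnW hj) //;
      last exact: ltnW (ltnW hj).
    by rewrite pmulr_rlt0 // turn_swap oppr_lt0.
  have up i j : (i.+1 < m)%N -> (j < k)%N -> 0 < s v i j -> 0 < s v i.+1 j.
    move=> hi hj hs; have [_ _ _ h] := face _ _ (ltnW hi) hj hs.
    have [_ [+ _ _ _]] := zh i.+1 j.+1 hi hj.
    rewrite /opposite_sides /= (dot_turns hv) ?hvp ?(ltnW hi) ?(ltnW hj) //;
      last exact: ltnW (ltnW hi).
    by rewrite turn_swap mulNr oppr_lt0 pmulr_rgt0.
  have col0 i : (i < m)%N -> 0 < s v i 0%N.
    by elim: i => // i IH hi; apply: up => //; apply/IH/ltnW.
  have all i j : (i < m)%N -> (j < k)%N -> 0 < s v i j.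
    move=> hi; elim: j => [|j IH] hj; first exact: col0.
    by apply: right => //; apply/IH/ltnW.
  by move=> i j hi hj; apply/face/all.
have := convp 1%N 1%N m0 k0 => /(convex_turns hn).
rewrite !hp // => /(_ erefl erefl erefl) [_ _ _].
rewrite neq_lt => /orP[sn|sp]; last by exists n; split=> //; apply: pos.
exists (- n).
have hN : dot (- n) (- n) = 1 by rewrite dotNl dotNr opprK.
have hpN i j i' j' : (i <= m)%N -> (j <= k)%N -> (i' <= m)%N -> (j' <= k)%N ->
    dot (- n) (p i j - p i' j') = 0.
  by move=> *; rewrite dotNl hp // oppr0.
split=> //; apply: pos => //.
by rewrite /s /turn dotNl oppr_gt0.
Qed.

Lemma face_angle_dir n (o a b : 'rV[R]_3) (x : R) : dot n n = 1 ->
  dot n (a - o) = 0 -> dot n (b - o) = 0 -> 0 < turn n o a b ->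
  0 < x -> tan (angle a o b / 2) = x ->
  unit_vec (b - o) = cos2 x *: unit_vec (a - o)
                     + sin2 x *: cross n (unit_vec (a - o)).
Proof. by move=> hn ha hb hab x0; apply: turn_dir. Qed.

Lemma angleC (a b o : 'rV[R]_3) : angle a o b = angle b o a.
Proof. by rewrite /angle dotC (mulrC (enorm _)). Qed.

Lemma turn_neq n (a b c : 'rV[R]_3) : 0 < turn n a b c -> b - a != 0.
Proof.
by apply: contraTneq => h; rewrite /turn h (_ : dot _ _ = 0) ?ltxx //; vec_ring.
Qed.

(** The edges [e1], [e2], [f1], [f2] go up, left, right and down; the order right, up, left, down is
    counterclockwise with respect to [n]. *)
Lemma net_corner (m k : nat) (p : nat -> nat -> 'rV[R]_3) n i j (x y : R) :
  dot n n = 1 ->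
  (forall i j i' j', (i <= m)%N -> (j <= k)%N -> (i' <= m)%N -> (j' <= k)%N ->
     dot n (p i j - p i' j') = 0) ->
  (forall i j, (i < m)%N -> (j < k)%N ->
     positive_face n (p i j) (p i j.+1) (p i.+1 j.+1) (p i.+1 j)) ->
  (i.+1 < m)%N -> (j.+1 < k)%N -> 0 < x -> 0 < y ->
  half_angle_tangents p i.+1 j.+1 x y y^-1 x^-1 ->
  let o := p i.+1 j.+1 in
  flat_corner n x y
    (unit_vec (p i.+2 j.+1 - o)) (unit_vec (p i.+1 j - o))
    (unit_vec (p i.+1 j.+2 - o)) (unit_vec (p i j.+1 - o)).
Proof.
move=> hn hp hf hi hj x0 y0 [UL UR LL LR] o.
have [i1 j1] := (ltnW hi, ltnW hj); have [i2 j2] := (ltnW i1, ltnW j1).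
have [_ ul _ _] := hf i.+1 j hi j1.
have [ur _ _ _] := hf i.+1 j.+1 hi hj.
have [_ _ ll _] := hf i j i1 j1.
have yV0 : 0 < y^-1 by rewrite invr_gt0.
have hu := turn_neq ul.
have hr := turn_neq ur.
have nu : dot n (p i.+2 j.+1 - o) = 0 by exact: hp.
have nr : dot n (p i.+1 j.+2 - o) = 0 by exact: hp.
have nl : dot n (p i.+1 j - o) = 0 by exact: hp.
have nd : dot n (p i j.+1 - o) = 0 by exact: hp.
have E1 := face_angle_dir hn nu nl ul x0 UL.
have E2 := face_angle_dir hn nr nu ur y0 (etrans (congr1 (fun a => tan (a /
  2)) (angleC _ _ _)) UR).
have E3 := face_angle_dir hn nl nd ll yV0 (etrans (congr1 (fun a => tan (a /
  2)) (angleC _ _ _)) LL).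
have hnr : dot n (unit_vec (p i.+1 j.+2 - o)) = 0 by rewrite dotZr nr mulr0.
split; rewrite ?unit_vecK //; first by rewrite dotZr nu mulr0.
split=> //; last by rewrite E3 cos2V ?lt0r_neq0 // sin2V ?lt0r_neq0.
(* [E2] obtains the upward direction from the right one; here this turn is inverted. *)
have [_ _ J] := turn_unit hn (unit_vecK hr) hnr (cos2_sin2 y).
rewrite E2 J -[LHS]scale1r -(cos2_sin2 y).
by set f := cross n _; vec_eq.
Qed.

End PlanarNets.

(** * Rigidity *)

Section Rigidity.
Variable R : realType.
Implicit Types (n : 'rV[R]_3) (t x y : R).

Lemma rigid_motionB (A : 'M[R]_3) (b x y : 'rV[R]_3) :
  rigid_motion A b x - rigid_motion A b y = (x - y) *m A.
Proof. by rewrite /rigid_motion opprD addrACA subrr addr0 mulmxBl. Qed.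

Lemma proportional_eq0 (P Q r r' s s' : R) : r' * P = r * Q ->
  s' * P = s * Q -> r * s' != r' * s -> P = 0 /\ Q = 0.
Proof.
move=> h1 h2 rs.
have d : r * s' - r' * s != 0 by rewrite subr_eq0.
split; apply: (mulfI d); rewrite mulr0 mulrBl.
  rewrite -mulrA h2 mulrAC h1; ring.
have -> : r * s' * Q - r' * s * Q = (r * Q) * s' - r' * (s * Q) by ring.
by rewrite -h1 -h2; ring.
Qed.

(* V, H0, H1 are cosines of dihedral angles; where the tangents of the half
   angles are finite and nonzero, the hypotheses and the conclusion are ratios
   of their squares.  When V = +-1 the conclusion is 0 = 0. *)
Lemma column_ratio (V H0 H1 r r' : R) : r != 0 -> r' != 0 ->
  (1 - V) * (1 + H0) = r * ((1 + V) * (1 - H0)) ->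
  (1 - V) * (1 + H1) = r' * ((1 + V) * (1 - H1)) ->
  r' * ((1 + H0) * (1 - H1)) = r * ((1 - H0) * (1 + H1)).
Proof.
move=> r0 r1 h0 h1.
have [V1|V1] := eqVneq V 1.
  have [H0e H1e] : H0 = 1 /\ H1 = 1; last by rewrite H0e H1e; ring.
  split.
    apply/eqP; rewrite eq_sym -subr_eq0 -(mulrI_eq0 _ (mulfI r0)); apply/eqP.
    move: h0; rewrite V1; lra.
  apply/eqP; rewrite eq_sym -subr_eq0 -(mulrI_eq0 _ (mulfI r1)); apply/eqP.
  move: h1; rewrite V1; lra.
have [V2|V2] := eqVneq V (- 1).
  have [H0e H1e] : H0 = - 1 /\ H1 = - 1; last by rewrite H0e H1e; ring.
  by split; [move: h0|move: h1]; rewrite V2; lra.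
have d : (1 + V) * (1 - V) != 0.
  by apply: mulf_neq0; [rewrite addrC addr_eq0 | rewrite subr_eq0 eq_sym].
apply: (mulfI d).
have -> : (1 + V) * (1 - V) * (r' * ((1 + H0) * (1 - H1))) =
  ((1 - V) * (1 + H0)) * (r' * ((1 + V) * (1 - H1))) by ring.
by rewrite -h1 h0; ring.
Qed.

(* In the half-angle tangents of the dihedral angles, this says
   v^2 / h^2 = ((x + y) / (x - y))^2 or ((1 - x y) / (1 + x y))^2. *)
Definition fold_relation (x y V H : R) : Prop :=
  ((x - y) ^+ 2 * ((1 - V) * (1 + H)) - (x + y) ^+ 2 * ((1 + V) * (1 - H))) *
  ((1 + x * y) ^+ 2 * ((1 - V) * (1 + H))
   - (1 - x * y) ^+ 2 * ((1 + V) * (1 - H))) = 0.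

Lemma fold_relation_ratio (x y c d V H : R) : x - y != 0 -> 1 + x * y != 0 ->
  c * (x - y) ^+ 2 = (x + y) ^+ 2 -> d * (1 + x * y) ^+ 2 = (1 - x * y) ^+ 2 ->
  fold_relation x y V H ->
  (1 - V) * (1 + H) = c * ((1 + V) * (1 - H)) \/
  (1 - V) * (1 + H) = d * ((1 + V) * (1 - H)).
Proof.
move=> h1 h2 hc hd /eqP; rewrite mulf_eq0 !subr_eq0 -hc -hd.
case/orP => /eqP h; [left|right].
  by apply: (mulfI (expf_neq0 2 h1)); rewrite h; ring.
by apply: (mulfI (expf_neq0 2 h2)); rewrite h; ring.
Qed.

(** * Dihedral angles along an isometric deformation *)

Section Deformation.
Variables (m k : nat) (p : nat -> nat -> 'rV[R]_3) (e : R)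
  (q : R -> nat -> nat -> 'rV[R]_3)
  (A : nat -> nat -> R -> 'M[R]_3) (b : nat -> nat -> R -> 'rV[R]_3).
Hypothesis def : isometric_deformation m k p e q A b.

Lemma deformation_vertical_edge t i j : - e < t < e ->
  (i < m)%N -> (j.+1 < k)%N ->
  (p i.+1 j.+1 - p i j.+1) *m A i.+1 j.+1 t =
  (p i.+1 j.+1 - p i j.+1) *m A i.+1 j.+2 t.
Proof.
move=> ht hi hj.
have [_ E1 E2 _] := motion_face def (hi : 0 < i.+1 <= m)%N
  (ltnW hj : 0 < j.+1 <= k)%N ht.
have [E3 _ _ E4] := motion_face def (hi : 0 < i.+1 <= m)%N
  (hj : 0 < j.+2 <= k)%N ht.
by rewrite -(rigid_motionB _ (b i.+1 j.+1 t)) -(rigid_motionB _ (b i.+1 j.+2 t))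
  -E1 -E2 -E3 -E4.
Qed.

Lemma deformation_horizontal_edge t i j : - e < t < e ->
  (i.+1 < m)%N -> (j < k)%N ->
  (p i.+1 j.+1 - p i.+1 j) *m A i.+1 j.+1 t =
  (p i.+1 j.+1 - p i.+1 j) *m A i.+2 j.+1 t.
Proof.
move=> ht hi hj.
have [_ _ E1 E2] := motion_face def (ltnW hi : 0 < i.+1 <= m)%N
  (hj : 0 < j.+1 <= k)%N ht.
have [E3 E4 _ _] := motion_face def (hi : 0 < i.+2 <= m)%N
  (hj : 0 < j.+1 <= k)%N ht.
by rewrite -(rigid_motionB _ (b i.+1 j.+1 t)) -(rigid_motionB _ (b i.+2 j.+1 t))
  -E1 -E2 -E3 -E4.
Qed.

Variable n : 'rV[R]_3.
Hypothesis hn : dot n n = 1.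
Hypothesis hp : forall i j i' j', (i <= m)%N -> (j <= k)%N ->
  (i' <= m)%N -> (j' <= k)%N -> dot n (p i j - p i' j') = 0.
Hypothesis hf : forall i j, (i < m)%N -> (j < k)%N ->
     positive_face n (p i j) (p i j.+1) (p i.+1 j.+1) (p i.+1 j).

(* Cosines of the dihedral angles at the edges between horizontally, resp.
   vertically, adjacent faces; faces are numbered from 0. *)
Definition fold_v i j t := dot (n *m A i.+1 j.+1 t) (n *m A i.+1 j.+2 t).
Definition fold_h i j t := dot (n *m A i.+1 j.+1 t) (n *m A i.+2 j.+1 t).

Lemma vertex_folds t i j x y : - e < t < e -> (i.+1 < m)%N -> (j.+1 < k)%N ->
  0 < x -> 0 < y ->
  half_angle_tangents p i.+1 j.+1 x y y^-1 x^-1 ->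
  [/\ fold_v i.+1 j t = fold_v i j t, fold_h i j.+1 t = fold_h i j t &
      fold_relation x y (fold_v i j t) (fold_h i j t)].
Proof.
move=> ht hi hj x0 y0 hhalf.
have hc := net_corner hn hp hf hi hj x0 y0 hhalf.
have [i1 j1] := (ltnW hi, ltnW hj).
have rot i' j' : (i' < m)%N -> (j' < k)%N -> rotation (A i'.+1 j'.+1 t).
  by move=> *; exact: (motion_rigid def).
(* At a corner all edges point away from the vertex, while the edge lemmas orient them by increasing
   index; two of the four have to be reversed. *)
have flip (c : R) (u v : 'rV[R]_3) (B C : 'M[R]_3) :
    (u - v) *m B = (u - v) *m C -> (c *: (v - u)) *m B = (c *: (v - u)) *m C.
  by move=> E; rewrite -opprB -!scalemxAl !mulNmx E.
have [] := corner_rigidity x0 y0 hc (rot i.+1 j hi j1) (rot i.+1 j.+1 hi hj)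
  (rot i j i1 j1) (rot i j.+1 i1 hj).
- by rewrite -!scalemxAl deformation_vertical_edge.
- by apply: flip; rewrite deformation_horizontal_edge.
- by rewrite -!scalemxAl deformation_horizontal_edge.
- by apply: flip; rewrite deformation_vertical_edge.
rewrite [dot (n *m A i.+2 j.+1 t) (n *m A i.+1 j.+1 t)]dotC.
rewrite [dot (n *m A i.+2 j.+2 t) (n *m A i.+1 j.+2 t)]dotC.
rewrite -/(fold_v i j t) -/(fold_v i.+1 j t) -/(fold_h i j t).
rewrite -/(fold_h i j.+1 t) => h1 h2 h3.
by split; [rewrite h1|rewrite h2|rewrite /fold_relation h1].
Qed.

Lemma no_fold_trivial t : - e < t < e ->
  (forall i j, (i < m)%N -> (j.+1 < k)%N -> fold_v i j t = 1) ->
  (forall i j, (i.+1 < m)%N -> (j < k)%N -> fold_h i j t = 1) ->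
  forall i j, (i < m)%N -> (j < k)%N ->
    A i.+1 j.+1 t = A 1%N 1%N t /\ b i.+1 j.+1 t = b 1%N 1%N t.
Proof.
move=> ht hv hh.
have rot i' j' : (i' < m)%N -> (j' < k)%N -> rotation (A i'.+1 j'.+1 t).
  by move=> *; exact: (motion_rigid def).
have nE (u v : 'rV[R]_3) : dot n (u - v) = 0 -> dot n (unit_vec (u - v)) = 0.
  by move=> h; rewrite dotZr h mulr0.
have shift (x : 'rV[R]_3) (B B' : 'M[R]_3) (c c' : 'rV[R]_3) :
    rigid_motion B c x = rigid_motion B' c' x -> B = B' -> c = c'.
  by rewrite /rigid_motion => + E; rewrite E => /addrI.
have right i j : (i < m)%N -> (j.+1 < k)%N ->
    A i.+1 j.+1 t = A i.+1 j.+2 t /\ b i.+1 j.+1 t = b i.+1 j.+2 t.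
  move=> hi hj; have [_ + _ _] := hf hi (ltnW hj) => /turn_neq nz.
  have EA : A i.+1 j.+1 t = A i.+1 j.+2 t.
    apply: (fold_trivial hn (unit_vecK nz) (nE _ _ _)) => //.
    - by apply: hp; rewrite // ltnW.
    - exact/rot/ltnW.
    - exact/rot.
    - by rewrite -!scalemxAl deformation_vertical_edge.
    - exact: hv.
  split=> //.
  have [_ E1 _ _] := motion_face def (hi : 0 < i.+1 <= m)%N
    (ltnW hj : 0 < j.+1 <= k)%N ht.
  have [E3 _ _ _] := motion_face def (hi : 0 < i.+1 <= m)%N
    (hj : 0 < j.+2 <= k)%N ht.
  exact: shift (etrans (esym E1) E3) EA.
have up i j : (i.+1 < m)%N -> (j < k)%N ->
    A i.+1 j.+1 t = A i.+2 j.+1 t /\ b i.+1 j.+1 t = b i.+2 j.+1 t.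
  move=> hi hj; have [_ _ + _] := hf (ltnW hi) hj => /turn_neq nz.
  have nz' : p i.+1 j.+1 - p i.+1 j != 0 by rewrite -opprB oppr_eq0.
  have EA : A i.+1 j.+1 t = A i.+2 j.+1 t.
    apply: (fold_trivial hn (unit_vecK nz') (nE _ _ _)) => //.
    - by apply: hp; rewrite // ltnW.
    - exact/rot/hj/ltnW.
    - exact/rot.
    - by rewrite -!scalemxAl deformation_horizontal_edge.
    - exact: hh.
  split=> //.
  have [_ _ E1 _] := motion_face def (ltnW hi : 0 < i.+1 <= m)%N
    (hj : 0 < j.+1 <= k)%N ht.
  have [_ E3 _ _] := motion_face def (hi : 0 < i.+2 <= m)%N
    (hj : 0 < j.+1 <= k)%N ht.
  exact: shift (etrans (esym E1) E3) EA.
move=> i j hi; elim: j => [k0|j IH hj].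
  elim: i hi => // i IH hi.
  have [<- <-] := up i 0%N hi k0; exact/IH/ltnW.
have [<- <-] := right i j hi hj; exact/IH/ltnW.
Qed.

End Deformation.
End Rigidity.

(** * Continuity of the dihedral angles *)

Section FoldContinuity.
Variable R : realType.
Implicit Types (n : 'rV[R]_3) (t : R).

Lemma derivable_sum3 (f g h : R -> R) t :
  derivable f t 1 -> derivable g t 1 -> derivable h t 1 ->
  derivable (fun s => f s + g s + h s) t 1.
Proof. by move=> hf hg hh; exact: (derivableD (derivableD hf hg) hh). Qed.

Lemma derivable_mulmx_row n (A : R -> 'M[R]_3) t k :
  derivable A t 1 -> derivable (fun s => (n *m A s) 0 k) t 1.
Proof.
move=> /derivable_mxP hA.
have D l : derivable (fun s => n 0 l * A s l k) t 1.
  exact: (derivableM (derivable_cst (n 0 l) t 1) (hA l k)).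
have -> : (fun s => (n *m A s) 0 k) =
    fun s => n 0 0 * A s 0 k + n 0 1 * A s 1 k + n 0 2%:R * A s 2%:R k.
  by apply/funext => s; rewrite mulmx_row3E.
exact: derivable_sum3.
Qed.

Lemma derivable_fold n (A B : R -> 'M[R]_3) t :
  derivable A t 1 -> derivable B t 1 ->
  derivable (fun s => dot (n *m A s) (n *m B s)) t 1.
Proof.
move=> hA hB.
have D l : derivable (fun s => (n *m A s) 0 l * (n *m B s) 0 l) t 1.
  exact: (derivableM (@derivable_mulmx_row n _ t l hA) (@derivable_mulmx_row n
    _ t l hB)).
have -> : (fun s => dot (n *m A s) (n *m B s)) = fun s =>
  (n *m A s) 0 0 * (n *m B s) 0 0 + (n *m A s) 0 1 * (n *m B s) 0 1 +
  (n *m A s) 0 2%:R * (n *m B s) 0 2%:R.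
  by apply/funext => s; rewrite dotE.
exact: derivable_sum3.
Qed.

(** Otherwise the intermediate value theorem yields a time at which [f] vanishes. *)
Lemma two_valued_constant (f : R -> R) (e : R) :
  (forall t, - e < t < e -> {for t, continuous f}) -> f 0 = 1 ->
  (forall t, - e < t < e -> f t = 1 \/ f t = - 1) ->
  forall t, - e < t < e -> f t = 1.
Proof.
move=> cf f0 h t ht; case: (h t ht) => // ft.
have sub a b : - e < a -> b < e -> {within `[a, b], continuous f}.
  move=> ha hb; apply: continuous_in_subspaceT => x; rewrite inE /= in_itv /=.
  by move=> /andP[h1 h2]; apply: cf; apply/andP; split; lra.
have zero a b : - e < a -> b < e -> a <= b ->
    Num.min (f a) (f b) <= 0 <= Num.max (f a) (f b) -> False.
  move=> ha hb hab hm; have [x] := IVT hab (sub a b ha hb) hm.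
  rewrite in_itv /= => /andP[h1 h2].
  have : - e < x < e by apply/andP; split; lra.
  by move=> /h[] ->; lra.
exfalso; case/andP: ht => h1 h2; have [t0|t0] := leP 0 t.
  apply: (zero 0 t) => //; first lra.
  by rewrite f0 ft ge_min le_max lerN10 ler01 ?orbT.
apply: (zero t 0); rewrite ?(ltW t0) //; first lra.
by rewrite f0 ft ge_min le_max lerN10 ler01 ?orbT.
Qed.

End FoldContinuity.

(** * Rigidity of the 3 x 4 net *)

Section FlatNetRigid.
Variable R : realType.

Lemma prescribed_net_rigid (p : nat -> nat -> 'rV[R]_3) :
  prescribed_net p -> ~ flexible 3 4 p.
Proof.
move=> net [e [q [A [b [def]]]]]; apply.
have [n [hn hp hf]] := planar_net_orientation (isT : 0 < 3)%N (isT : 0 < 4)%N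
  (prescribed_planar net) (prescribed_convex net) (prescribed_dihedral net).
have e0 := deformation_gt0 def.
have vtx (t : R) i j (x y x' y' : R) : - e < t < e -> (i < 2)%N -> (j < 3)%N ->
    0 < x -> 0 < y -> y * y' = 1 -> x * x' = 1 ->
    half_angle_tangents p i.+1 j.+1 x y y' x' ->
    [/\ fold_v A n i.+1 j t = fold_v A n i j t,
        fold_h A n i j.+1 t = fold_h A n i j t &
        fold_relation x y (fold_v A n i j t) (fold_h A n i j t)].
  move=> ht hi hj x0 y0 /mulr1_eq <- /mulr1_eq <- hh.
  exact: (vertex_folds def hn hp hf).
have V (t : R) : - e < t < e ->
  [/\ forall i j, (i < 2)%N -> (j < 3)%N ->
        fold_v A n i.+1 j t = fold_v A n i j t,
      forall i j, (i < 2)%N -> (j < 3)%N ->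
        fold_h A n i j.+1 t = fold_h A n i j t &
      [/\ fold_relation 2 (3/2) (fold_v A n 0 0 t) (fold_h A n 0 0 t),
          fold_relation (2/3) (7/6) (fold_v A n 0 1 t) (fold_h A n 0 0 t),
          fold_relation (3/2) (51/76) (fold_v A n 0 2 t) (fold_h A n 0 0 t),
          fold_relation (1/2) (3/2) (fold_v A n 0 0 t) (fold_h A n 1 0 t) &
          fold_relation (7/4) (7/6) (fold_v A n 0 2 t) (fold_h A n 1 0 t)]].
  move=> ht.
  have [v11 h11 r11] := vtx t 0%N 0%N (2) (3/2) (1/2) (2/3) ht isT isT
    ltac:(clear; lra) ltac:(clear; lra) ltac:(clear; lra) ltac:(clear; lra)
      (prescribed_11 net).
  have [v12 h12 r12] := vtx t 0%N 1%N (2/3) (7/6) (3/2) (6/7) ht isT isT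
    ltac:(clear; lra) ltac:(clear; lra) ltac:(clear; lra) ltac:(clear; lra)
      (prescribed_12 net).
  have [v13 h13 r13] := vtx t 0%N 2%N (3/2) (51/76) (2/3) (76/51) ht isT isT
    ltac:(clear; lra) ltac:(clear; lra) ltac:(clear; lra) ltac:(clear; lra)
      (prescribed_13 net).
  have [v21 h21 r21] := vtx t 1%N 0%N (1/2) (3/2) (2) (2/3) ht isT isT
    ltac:(clear; lra) ltac:(clear; lra) ltac:(clear; lra) ltac:(clear; lra)
      (prescribed_21 net).
  have [v22 h22 r22] := vtx t 1%N 1%N (3/2) (2) (2/3) (1/2) ht isT isT
    ltac:(clear; lra) ltac:(clear; lra) ltac:(clear; lra) ltac:(clear; lra)
      (prescribed_22 net).
  have [v23 h23 r23] := vtx t 1%N 2%N (7/4) (7/6) (4/7) (6/7) ht isT isT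
    ltac:(clear; lra) ltac:(clear; lra) ltac:(clear; lra) ltac:(clear; lra)
      (prescribed_23 net).
  rewrite h12 h11 in r13; rewrite h11 in r12; rewrite v11 in r21.
  rewrite v13 h22 h21 in r23.
  split=> //; by move=> [|[|//]] [|[|[|//]]].
have H (t : R) : - e < t < e ->
    fold_h A n 0 0 t = 1 \/ fold_h A n 0 0 t = -1.
  move=> /V[_ _ [r11 _ r13 r21 r23]].
  move: (fold_v A n 0 0 t) (fold_v A n 0 2 t) (fold_h A n 0 0 t) (fold_h A n 1
    0 t) r11 r13 r21 r23 => V0 V2 H0 H1 r11 r13 r21 r23.
  (* These are the numerator and the denominator of the quotient of the squared half-angle tangents
     of the two horizontal lines. Two columns prescribing different quotients force both to
     vanish. *)
  suff [P Q] : (1 + H0) * (1 - H1) = 0 /\ (1 - H0) * (1 + H1) = 0.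
    move/eqP: P; rewrite mulf_eq0 => /orP[/eqP h|/eqP h]; first by right; lra.
    left; have h1 : H1 = 1 by lra.
    by move: Q; rewrite h1; lra.
  (* Here and in the next three claims the constants are [((x + y) / (x - y)) ^+ 2] and
     [((1 - x * y) / (1 + x * y)) ^+ 2] at the vertex concerned. *)
  have {r11} r11 : (1 - V0) * (1 + H0) = 49 * ((1 + V0) * (1 - H0)) \/
      (1 - V0) * (1 + H0) = 1 / 4 * ((1 + V0) * (1 - H0)).
    by apply: fold_relation_ratio r11; clear; first [lra | apply/eqP; lra].
  have {r21} r21 : (1 - V0) * (1 + H1) = 4 * ((1 + V0) * (1 - H1)) \/
      (1 - V0) * (1 + H1) = 1 / 49 * ((1 + V0) * (1 - H1)).
    by apply: fold_relation_ratio r21; clear; first [lra | apply/eqP; lra].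
  have {r13} r13 : (1 - V2) * (1 + H0) = (55 / 21) ^+ 2 * ((1 + V2) * (1 -
    H0)) \/
      (1 - V2) * (1 + H0) = (1 / 305) ^+ 2 * ((1 + V2) * (1 - H0)).
    by apply: fold_relation_ratio r13; clear; first [lra | apply/eqP; lra].
  have {r23} r23 : (1 - V2) * (1 + H1) = 25 * ((1 + V2) * (1 - H1)) \/
      (1 - V2) * (1 + H1) = (25 / 73) ^+ 2 * ((1 + V2) * (1 - H1)).
    by apply: fold_relation_ratio r23; clear; first [lra | apply/eqP; lra].
  have clash (r r' s s' : R) : 0 < r -> 0 < r' -> 0 < s -> 0 < s' ->
      r * s' != r' * s ->
      (1 - V0) * (1 + H0) = r * ((1 + V0) * (1 - H0)) ->
      (1 - V0) * (1 + H1) = r' * ((1 + V0) * (1 - H1)) ->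
      (1 - V2) * (1 + H0) = s * ((1 + V2) * (1 - H0)) ->
      (1 - V2) * (1 + H1) = s' * ((1 + V2) * (1 - H1)) ->
      (1 + H0) * (1 - H1) = 0 /\ (1 - H0) * (1 + H1) = 0.
    move=> h1 h2 h3 h4 neq k1 k2 k3 k4.
    have c1 := column_ratio (lt0r_neq0 h1) (lt0r_neq0 h2) k1 k2.
    have c3 := column_ratio (lt0r_neq0 h3) (lt0r_neq0 h4) k3 k4.
    exact: (proportional_eq0 c1 c3 neq).
  by case: r11 r21 r13 r23 => [k1|k1] [k2|k2] [k3|k3] [k4|k4];
    apply: (clash _ _ _ _ _ _ _ _ _ k1 k2 k3 k4); clear;
    first [lra | apply/eqP; lra].
have H1 (t : R) : - e < t < e -> fold_h A n 0 0 t = 1.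
  apply: (@two_valued_constant R (fold_h A n 0 0) e) t => [s hs||//].
    have [sA0 _] := motion_smooth def (isT : 0 < 1 <= 3)%N (isT : 0 < 1 <= 4)%N.
    have [sA1 _] := motion_smooth def (isT : 0 < 2 <= 3)%N (isT : 0 < 1 <= 4)%N.
    apply/differentiable_continuous/derivable1_diffP.
    exact: derivable_fold (sA0 0%N s hs) (sA1 0%N s hs).
  have [E0 _] := motion_start def (isT : 0 < 1 <= 3)%N (isT : 0 < 1 <= 4)%N.
  have [E1 _] := motion_start def (isT : 0 < 2 <= 3)%N (isT : 0 < 1 <= 4)%N.
  by rewrite /fold_h E0 E1 mulmx1.
have triv (t : R) : - e < t < e -> forall i j, (i < 3)%N -> (j < 4)%N ->
    A i.+1 j.+1 t = A 1%N 1%N t /\ b i.+1 j.+1 t = b 1%N 1%N t.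
  move=> ht; have h0 := H1 t ht.
  have [vE hE [r11 r12 r13 r21 r23]] := V t ht.
  rewrite h0 in r11 r12 r13.
  have flat (x y V0 : R) : x - y != 0 -> 1 + x * y != 0 ->
      fold_relation x y V0 1 -> V0 = 1.
    move=> h1 h2 hr.
    (* For [H = 1] the subtracted terms vanish and the product of the two modes is a perfect
       square. *)
    have /eqP : (2 * ((x - y) * (1 + x * y)) * (1 - V0)) ^+ 2 = 0.
      by rewrite -[RHS]hr; ring.
    rewrite sqrf_eq0 !mulf_eq0 (negPf h1) (negPf h2) pnatr_eq0 /= subr_eq0.
    by move=> /eqP.
  have v0 : fold_v A n 0 0 t = 1.
    apply: (flat 2 (3/2)); last exact: r11; clear; apply/eqP; lra.
  have v1 : fold_v A n 0 1 t = 1.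
    apply: (flat (2/3) (7/6)); last exact: r12; clear; apply/eqP; lra.
  have v2 : fold_v A n 0 2 t = 1.
    apply: (flat (3/2) (51/76)); last exact: r13; clear; apply/eqP; lra.
  have h1 : fold_h A n 1 0 t = 1.
    (* With the vertical fold equal to 1, the relation at p_{2,1} is a nonzero multiple of this
       square, as x + y and 1 - x y are nonzero there. *)
    have : (1 - fold_h A n 1 0 t) ^+ 2 = 0.
      by move: r21; rewrite /fold_relation v0; lra.
    by move=> /eqP; rewrite sqrf_eq0 subr_eq0 => /eqP.
  apply: (no_fold_trivial def hn hp hf ht).
    have vr j : (j < 3)%N -> fold_v A n 0 j t = 1 by move: j => [|[|[|//]]].
    move=> [|[|[|//]]] j _ hj; [exact: vr|rewrite vE //; exact: vr|].
    by rewrite vE // vE //; exact: vr.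
  have hr i : (i < 2)%N -> fold_h A n i 0 t = 1 by move: i => [|[|//]].
  move=> i; elim=> [|j IH] hi hj; first exact: hr.
  by rewrite hE //; apply: IH => //; exact: ltnW.
move=> [//|i] [//|j] [//|i'] [//|j'] hi hj hi' hj' t ht.
have [-> ->] := triv t ht i j hi hj.
by have [-> ->] := triv t ht i' j' hi' hj'.
Qed.

End FlatNetRigid.

(** * Rotations from quaternions *)

Section Quaternions.
Variable R : realType.
Implicit Types (u v w n : 'rV[R]_3) (s t x y : R) (A B M : 'M[R]_3).

Definition skew_mx w : 'M[R]_3 := \matrix_(i, k) cross w (delta_mx 0 i) 0 k.

Lemma mulmx_skew v w : v *m skew_mx w = cross w v.
Proof.
have E i k : skew_mx w i k = cross w (delta_mx 0 i) 0 k by rewrite mxE.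
by apply: row3P; rewrite mulmx_row3E !E !vecE !mxE !eqE /=; ring.
Qed.

Lemma eq_mulmx_row A B : (forall v, v *m A = v *m B) -> A = B.
Proof. by move=> h; apply/row_matrixP => i; rewrite !rowE h. Qed.

(* Conjugation by the quaternion s + w, without the division by its norm. *)
Definition quat_mx s w : 'M[R]_3 :=
  (s ^+ 2 - dot w w)%:M + (2 * s) *: skew_mx w + 2 *: (w^T *m w).

Lemma mulmx_quat v s w : v *m quat_mx s w =
  (s ^+ 2 - dot w w) *: v + (2 * s) *: cross w v + (2 * dot v w) *: w.
Proof.
rewrite !mulmxDr mul_mx_scalar -!scalemxAr mulmx_skew mulmxA.
by rewrite (mx11_scalar (v *m w^T)) -/(dot v w) mul_scalar_mx scalerA.
Qed.

(** Matrices act on row vectors from the right, so the quaternions are multiplied in the reverse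
    order. *)
Lemma quat_mxM s w s' w' : quat_mx s w *m quat_mx s' w' =
  quat_mx (s' * s - dot w' w) (s' *: w + s *: w' + cross w' w).
Proof.
apply: eq_mulmx_row => v; rewrite mulmxA !mulmx_quat.
vec_eq.
Qed.

Lemma tr_quat_mx s w : (quat_mx s w)^T = quat_mx s (- w).
Proof.
apply: eq_mulmx_row => v; apply: dot_inj => u.
by rewrite -dot_mulmxr !mulmx_quat; vec_ring.
Qed.

Lemma quat_mx_scalar s : quat_mx s 0 = (s ^+ 2)%:M.
Proof.
apply: eq_mulmx_row => v; rewrite mulmx_quat mul_mx_scalar; vec_eq.
Qed.

Lemma det_quat_mx s w : \det (quat_mx s w) = (s ^+ 2 + dot w w) ^+ 3.
Proof.
pose d k : 'rV[R]_3 := delta_mx 0 k.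
have dE k l : d k 0 l = (l == k)%:R by rewrite mxE.
(* The determinant is the triple product of the images of the standard basis. *)
have := triple_mulmx (d 0) (d 1) (d 2%:R) (quat_mx s w).
rewrite !mulmx_quat.
have -> : dot (cross (d 0) (d 1)) (d 2%:R) = 1 by rewrite !vecE !dE /=; ring.
rewrite mulr1 => <-.
by rewrite !vecE !dE /=; ring.
Qed.

(** The rotation about [w] by twice the arctangent of its length. Scaling the quaternion to real
    part 1 makes the entries along [t *: w] rational functions of [t]. *)
Definition rodrigues w : 'M[R]_3 := (1 + dot w w)^-1 *: quat_mx 1 w.

Lemma norm1D_gt0 w : 0 < 1 + dot w w.
Proof. by rewrite ltr_pwDl // dot_ge0. Qed.

Lemma rodrigues_rotation w : rotation (rodrigues w).
Proof.
have N0 := lt0r_neq0 (norm1D_gt0 w).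
split.
  rewrite linearZ /= tr_quat_mx -scalemxAl -scalemxAr scalerA quat_mxM.
  rewrite (_ : _ + cross _ _ = 0); last by vec_eq.
  rewrite quat_mx_scalar dotNl -scalemx1 scalerA.
  by rewrite -[RHS]scale1r; congr (_ *: _); field.
by rewrite detZ det_quat_mx expr1n -exprMn mulVf // expr1n.
Qed.

Lemma rodriguesM w w' : rodrigues w *m rodrigues w' =
  ((1 + dot w w) * (1 + dot w' w'))^-1 *:
  quat_mx (1 - dot w' w) (w + w' + cross w' w).
Proof.
rewrite /rodrigues -scalemxAl -scalemxAr scalerA quat_mxM invfM.
by rewrite mul1r !scale1r.
Qed.

Lemma rodrigues_axis t w : w *m rodrigues (t *: w) = w.
Proof.
rewrite -scalemxAr mulmx_quat; have := lt0r_neq0 (norm1D_gt0 (t *: w)).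
rewrite dotZl dotZr => N0; rewrite crossZl crossvv.
by apply: row3P; rewrite !vecE in N0 *; field.
Qed.

Lemma rodrigues_eq1 w : rodrigues w = 1%:M -> w = 0.
Proof.
move=> h; have N0 := lt0r_neq0 (norm1D_gt0 w).
have hv v : cross w v = 0.
  have := congr1 (mulmx v) h; rewrite mulmx1 -scalemxAr mulmx_quat => E.
  apply/eqP; rewrite -dot_eq0.
  (* Pairing with [cross w v] removes the terms along [v] and [w], leaving a nonzero multiple of its
     squared length. *)
  have := congr1 (fun u => dot u (cross w v)) E; rewrite !dot_lin dot_crossr
    !dot_crossl.
  rewrite !mulr0 addr0 add0r => /eqP; rewrite !mulf_eq0 invr_eq0 (negPf N0).
  by rewrite !pnatr_eq0 oner_eq0.
have dE k l : (delta_mx 0 k : 'rV[R]_3) 0 l = (l == k)%:R by rewrite mxE.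
have h0 k := congr1 (fun v : 'rV[R]_3 => v 0 k) (hv (delta_mx 0 0)).
have h1 k := congr1 (fun v : 'rV[R]_3 => v 0 k) (hv (delta_mx 0 1)).
move: (h0 1) (h0 2%:R) (h1 2%:R).
rewrite !vecE !dE /= !(mulr0, mulr1, subr0, sub0r).
by move=> e2 /eqP; rewrite oppr_eq0 => /eqP e1 e0; apply: row3P; rewrite
  zerov_E.
Qed.

End Quaternions.

(** * Closing of the fourth face at a vertex *)

Section Closing.
Variable R : realType.
Implicit Types (n e f : 'rV[R]_3) (x y t : R).

(* The face opposite to the fixed one is reached through f1 then e1 and
   through f2 then e2. *)
Definition closes (e1 e2 f1 f2 : 'rV[R]_3) (t1 t2 : R) : Prop :=
  exists s1 s2 : R, forall t,
    rodrigues (t *: (s1 *: f1)) *m rodrigues (t *: (t1 *: e1)) =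
    rodrigues (t *: (s2 *: f2)) *m rodrigues (t *: (t2 *: e2)).

(* Both sides are the rotation of a product of two quaternions; these products
   are equal as soon as their vector parts agree, which is the hypothesis eq. *)
Lemma closes_of_vectors n x y e1 e2 f1 f2 t1 t2 s :
  flat_corner n x y e1 e2 f1 f2 -> s ^+ 2 = 1 ->
  t1 *: e1 + (s * t2) *: f1 = t2 *: e2 - (s * t1) *: f2 ->
  closes e1 e2 f1 f2 t1 t2.
Proof.
(* Opposite folds agree up to sign: [f1] repeats [e2] and [f2] repeats [e1]. The sign [s]
   distinguishes the two modes. *)
move=> hc hs eq; exists (s * t2), (- (s * t1)) => t.
have [hn he1 hne1 [E2 F1 F2]] := hc.
have [he2 hne2 J2] := turn_unit hn he1 hne1 (cos2_sin2 x).
rewrite -E2 in he2 hne2 J2.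
have sq1 : cos2 y ^+ 2 + (- sin2 y) ^+ 2 = 1 by rewrite sqrrN cos2_sin2.
have sq2 : (- cos2 y) ^+ 2 + sin2 y ^+ 2 = 1 by rewrite sqrrN cos2_sin2.
have [hf1 _ _] := turn_unit hn he1 hne1 sq1.
rewrite scaleNr -F1 in hf1.
have [hf2 _ _] := turn_unit hn he2 hne2 sq2.
rewrite -F2 in hf2.
have d1 : dot e1 f1 = cos2 y.
  by rewrite F1 !dot_lin he1 dot_crossr; ring.
have d2 : dot e2 f2 = - cos2 y.
  by rewrite F2 !dot_lin he2 dot_crossr; ring.
have x1 : cross e1 f1 = - sin2 y *: n.
  rewrite F1 !cross_lin crossvv cross_cross he1 (dotC e1) hne1.
  by vec_eq.
have x2 : cross e2 f2 = sin2 y *: n.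
  rewrite F2 !cross_lin crossvv cross_cross he2 (dotC e2) hne2.
  by vec_eq.
(* The goals concern the norms, the scalar parts and the vector parts. In the last, [eq] settles the
   terms linear in [t]; the quadratic ones are equal multiples of [n] by [x1] and [x2]. *)
rewrite !rodriguesM; congr (_^-1 *: quat_mx _ _).
- rewrite !dot_lin he1 he2 hf1 hf2.
  transitivity ((1 + (t * t2) ^+ 2 * s ^+ 2) * (1 + (t * t1) ^+ 2)); first by
    ring.
  by rewrite hs; transitivity ((1 + (t * t1) ^+ 2 * s ^+ 2) * (1 + (t * t2) ^+
    2)); [rewrite hs|]; ring.
- by rewrite !dot_lin d1 d2; ring.
- rewrite !cross_lin x1 x2.
  have -> : t *: ((s * t2) *: f1) + t *: (t1 *: e1) =
    t *: (t1 *: e1 + (s * t2) *: f1) by vec_eq.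
  by rewrite eq; vec_eq.
Qed.

(** The mode [s = 1]. The vector condition amounts to two equations in the plane, but its defect is
    a scalar multiple of a fixed vector, so a single ratio suffices; it is that of the first factor
    of [fold_relation]. *)
Lemma closes_mode1 n x y e1 e2 f1 f2 t1 t2 :
  flat_corner n x y e1 e2 f1 f2 -> t1 * (y - x) = t2 * (x + y) ->
  closes e1 e2 f1 f2 t1 t2.
Proof.
move=> hc h; apply: (closes_of_vectors hc (expr1n _ 2)).
have [hn he1 hne1 [E2 F1 F2]] := hc.
have [_ _ J2] := turn_unit hn he1 hne1 (cos2_sin2 x).
have N1 := sqr1D_neq0 x; have N2 := sqr1D_neq0 y.
set J := cross n e1 in E2 F1 F2 J2.
apply/eqP; rewrite -subr_eq0; apply/eqP.
have -> : t1 *: e1 + (1 * t2) *: f1 - (t2 *: e2 - (1 * t1) *: f2) =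
  ((t1 * (y - x) - t2 * (x + y)) * (2 / ((1 + x ^+ 2) * (1 + y ^+ 2)))) *:
   ((y - x) *: e1 + (1 + x * y) *: J).
  rewrite F2 E2 J2 F1 /cos2 /sin2.
  by apply: row3P; rewrite !(addv_E, oppv_E, scalev_E); field; rewrite N1 N2.
by rewrite h subrr mul0r scale0r.
Qed.

(** The mode [s = - 1], which belongs to the second factor of [fold_relation]. *)
Lemma closes_mode2 n x y e1 e2 f1 f2 t1 t2 :
  flat_corner n x y e1 e2 f1 f2 -> t1 * (1 + x * y) = t2 * (1 - x * y) ->
  closes e1 e2 f1 f2 t1 t2.
Proof.
move=> hc h; apply: (closes_of_vectors hc (_ : (- 1) ^+ 2 = 1)).
  by rewrite sqrrN expr1n.
have [hn he1 hne1 [E2 F1 F2]] := hc.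
have [_ _ J2] := turn_unit hn he1 hne1 (cos2_sin2 x).
have N1 := sqr1D_neq0 x; have N2 := sqr1D_neq0 y.
set J := cross n e1 in E2 F1 F2 J2.
apply/eqP; rewrite -subr_eq0; apply/eqP.
have -> : t1 *: e1 + (- 1 * t2) *: f1 - (t2 *: e2 - (- 1 * t1) *: f2) =
  ((t1 * (1 + x * y) - t2 * (1 - x * y)) * (2 / ((1 + x ^+ 2) * (1 + y ^+
    2)))) *:
   ((1 + x * y) *: e1 - (y - x) *: J).
  rewrite F2 E2 J2 F1 /cos2 /sin2.
  by apply: row3P; rewrite !(addv_E, oppv_E, scalev_E); field; rewrite N1 N2.
by rewrite h subrr mul0r scale0r.
Qed.

End Closing.

(** * Smooth families *)

Section RationalFamilies.
Variable R : realType.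

(* Matrices of rational functions with a common denominator without real
   zeros: a class stable under derivation, hence made of smooth functions. *)
Definition rational_family (m n : nat) (f : R -> 'M[R]_(m, n)) : Prop :=
  exists (D : {poly R}) (P : 'M[{poly R}]_(m, n)),
    forall t, D.[t] != 0 /\ f t = D.[t]^-1 *: map_mx (horner^~ t) P.

Lemma rational_cst m n (A : 'M[R]_(m, n)) : rational_family (fun=> A).
Proof.
exists 1, (map_mx polyC A) => t; rewrite hornerC oner_neq0 invr1 scale1r.
by split=> //; apply/matrixP => i j; rewrite !mxE hornerC.
Qed.

Lemma rational_add m n (f g : R -> 'M[R]_(m, n)) :
  rational_family f -> rational_family g -> rational_family (fun t => f t + g
    t).
Proof.
move=> [D [P hP]] [E [Q hQ]]; exists (D * E), (E *: P + D *: Q) => t.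
have [[D0 ->] [E0 ->]] := (hP t, hQ t).
rewrite hornerM mulf_neq0 //; split=> //.
apply/matrixP => i j; rewrite !mxE hornerD !hornerM; field.
by rewrite D0 E0.
Qed.

Lemma rational_mul m n k (f : R -> 'M[R]_(m, n)) (g : R -> 'M[R]_(n, k)) :
  rational_family f -> rational_family g ->
  rational_family (fun t => f t *m g t).
Proof.
move=> [D [P hP]] [E [Q hQ]]; exists (D * E), (P *m Q) => t.
have [[D0 ->] [E0 ->]] := (hP t, hQ t).
rewrite hornerM mulf_neq0 //; split=> //.
rewrite -scalemxAl -scalemxAr scalerA -invfM; congr (_ *: _).
apply/matrixP => i j; rewrite !mxE horner_sum; apply: eq_bigr => l _.
by rewrite !mxE hornerM.
Qed.

Lemma rational_opp m n (f : R -> 'M[R]_(m, n)) :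
  rational_family f -> rational_family (fun t => - f t).
Proof.
move=> [D [P hP]]; exists D, (- P) => t; have [D0 ->] := hP t; split=> //.
by apply/matrixP => i j; rewrite !mxE hornerN mulrN.
Qed.

Lemma rational_rodrigues (w : 'rV[R]_3) :
  rational_family (fun t => rodrigues (t *: w)).
Proof.
exists (1 + (dot w w) *: 'X^2),
  (map_mx polyC 1%:M + 'X *: map_mx polyC (2 *: skew_mx w) +
   'X^2 *: map_mx polyC (2 *: (w^T *m w) - (dot w w)%:M)) => t.
have E : (1 + dot w w *: 'X^2).[t] = 1 + dot (t *: w) (t *: w).
  by rewrite !hornerE /= dotZl dotZr; ring.
rewrite E lt0r_neq0 ?norm1D_gt0 //; split=> //.
congr (_ *: _); apply: eq_mulmx_row => v; rewrite mulmx_quat.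
have -> : map_mx (horner^~ t) (map_mx polyC 1%:M +
   'X *: map_mx polyC (2 *: skew_mx w) +
   'X^2 *: map_mx polyC (2 *: (w^T *m w) - (dot w w)%:M)) =
  1%:M + t *: (2 *: skew_mx w) + t ^+ 2 *: (2 *: (w^T *m w) - (dot w w)%:M).
  apply/matrixP => i j; rewrite ![in LHS]mxE ![in RHS]mxE.
  by rewrite !hornerE /=.
rewrite !mulmxDr mulmx1 -!scalemxAr mulmxBr -!scalemxAr mulmx_skew mulmxA.
rewrite (mx11_scalar (v *m w^T)) -/(dot v w) mul_scalar_mx mul_mx_scalar.
vec_eq.
Qed.

Lemma derivable_rational_entry (D p : {poly R}) (t : R) : D.[t] != 0 ->
  is_derive t (1 : R) (fun s => D.[s]^-1 * p.[s])
    ((D ^+ 2).[t]^-1 * (D * p^`() - D^`() * p).[t]).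
Proof.
move=> D0; have hD := is_derive_poly D t; have hp := is_derive_poly p t.
have hV : is_derive t (1 : R) (fun s => D.[s]^-1) (- D.[t] ^- 2 *: D^`().[t]).
  apply: DeriveDef; first by apply: derivableV => //; exact: derivable_horner.
  by rewrite deriveV ?derive_val //; exact: derivable_horner.
have -> : (D ^+ 2).[t]^-1 * (D * p^`() - D^`() * p).[t] =
  D.[t]^-1 *: p^`().[t] + p.[t] *: (- D.[t] ^- 2 *: D^`().[t]).
  rewrite /GRing.scale /= !(hornerD, hornerN, hornerM, hornerXn, horner_exp).
  by field.
exact: (is_deriveM hV hp).
Qed.

Lemma rational_derivable m n (f : R -> 'M[R]_(m, n)) t :
  rational_family f -> derivable f t 1.
Proof.
move=> [D [P hP]]; apply/derivable_mxP => i j.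
have -> : (fun s => f s i j) = fun s => D.[s]^-1 * (P i j).[s].
  by apply/funext => s; have [_ ->] := hP s; rewrite !mxE.
have [D0 _] := hP t.
exact: (@ex_derive _ _ _ _ _ _ _ (derivable_rational_entry (P i j) D0)).
Qed.

Lemma rational_derive1 m n (f : R -> 'M[R]_(m, n)) :
  rational_family f -> rational_family (derive1 f).
Proof.
move=> hf; have [D [P hP]] := hf.
exists (D ^+ 2), (\matrix_(i, j) (D * (P i j)^`() - D^`() * P i j)) => t.
have [D0 _] := hP t; rewrite horner_exp expf_neq0 //; split=> //.
rewrite derive1E derive_mx; last exact: rational_derivable.
apply/matrixP => i j; rewrite !mxE.
have -> : (fun s => f s i j) = fun s => D.[s]^-1 * (P i j).[s].
  by apply/funext => s; have [_ ->] := hP s; rewrite !mxE.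
rewrite -horner_exp.
exact: (@derive_val _ _ _ _ _ _ _ (derivable_rational_entry (P i j) D0)).
Qed.

Lemma rational_smooth m n (f : R -> 'M[R]_(m, n)) e :
  rational_family f -> smooth_on e f.
Proof.
move=> hf k t _; apply: rational_derivable.
by elim: k => [//|k IH]; rewrite derive1nS; exact: rational_derive1.
Qed.

End RationalFamilies.

(** * Flexible 3 x 3 nets *)

Section Gluing.
Variable R : realType.
Implicit Types (u v w x : 'rV[R]_3) (A : 'M[R]_3) (b : 'rV[R]_3).

Lemma rigid_motion_inj A b : rotation A -> injective (rigid_motion A b).
Proof. by move=> rA x y /addIr; exact: (rotation_inj rA). Qed.

Lemma rigid_motion_segment A b u v :
  closed_segment (rigid_motion A b u) (rigid_motion A b v) =
  rigid_motion A b @` closed_segment u v.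
Proof.
rewrite /closed_segment; apply/seteqP; split=> [_ [s hs ->]|_ [x [s hs ->] <-]].
  exists (u + s *: (v - u)); first by exists s.
  by rewrite rigid_motionB /rigid_motion mulmxDl -scalemxAl addrAC.
exists s => //.
by rewrite rigid_motionB /rigid_motion mulmxDl -scalemxAl addrAC.
Qed.

Lemma rigid_motion_quadrilateral A b a c d f : rotation A ->
  planar_quadrilateral a c d f ->
  planar_quadrilateral (rigid_motion A b a) (rigid_motion A b c)
    (rigid_motion A b d) (rigid_motion A b f).
Proof.
move=> rA; set g := rigid_motion A b.
have ginj : injective g by exact: rigid_motion_inj.
have gI (S T : set 'rV[R]_3) : (g @` S) `&` (g @` T) = g @` (S `&` T).
  apply/seteqP; split=> [_ [[x Sx <-] [y Ty /ginj E]]|_ [x [Sx Tx] <-]].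
    by exists x => //; split=> //; rewrite -E.
  by split; exists x.
move=> [[w [c0 [w0 hw]]] [huniq h1 h2 [h3 h4 h5 h6]]]; split.
  exists (w *m A), (c0 + dot (w *m A) b); split.
    apply: contraNneq w0 => E.
    by apply/eqP/(rotation_inj rA); rewrite /= E mul0mx.
  have hg x : [set a; c; d; f] x -> dot (w *m A) (g x) = c0 + dot (w *m A) b.
    by move=> hx; rewrite dotDr rotation_dot // hw.
  by move=> x [[[->|->]|->]|->]; apply: hg;
    [do 3 left|do 2 left; right|left; right|right].
rewrite !rigid_motion_segment !gI h1 h2 h3 h4 h5 h6 !image_set0 !image_set1.
split=> //.
by rewrite -[X in uniq X]/(map g [:: a; c; d; f]) map_inj_uniq.
Qed.

Definition agree A b A' b' x : Prop := rigid_motion A b x = rigid_motion A' b'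
  x.

(* The position of p_{i,j} is read off the face whose last vertex it is, or the
   closest one on the lower and left boundaries. *)
Lemma deformation_of_motions (m k : nat) (p : nat -> nat -> 'rV[R]_3) (e : R)
    (A : nat -> nat -> R -> 'M[R]_3) (b : nat -> nat -> R -> 'rV[R]_3) :
  0 < e -> conjugate_net m k p ->
  (forall i j, rational_family (A i j) /\ rational_family (b i j)) ->
  (forall i j, A i j 0 = 1%:M /\ b i j 0 = 0) ->
  (forall i j t, rotation (A i j t)) ->
  (forall i j t, (i < m)%N -> (j.+1 < k)%N ->
     agree (A i.+1 j.+1 t) (b i.+1 j.+1 t) (A i.+1 j.+2 t) (b i.+1 j.+2 t)
       (p i j.+1) /\
     agree (A i.+1 j.+1 t) (b i.+1 j.+1 t) (A i.+1 j.+2 t) (b i.+1 j.+2 t)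
       (p i.+1 j.+1)) ->
  (forall i j t, (i.+1 < m)%N -> (j < k)%N ->
     agree (A i.+1 j.+1 t) (b i.+1 j.+1 t) (A i.+2 j.+1 t) (b i.+2 j.+1 t)
       (p i.+1 j) /\
     agree (A i.+1 j.+1 t) (b i.+1 j.+1 t) (A i.+2 j.+1 t) (b i.+2 j.+1 t)
       (p i.+1 j.+1)) ->
  isometric_deformation m k p e
    (fun t i j => rigid_motion (A (maxn i 1) (maxn j 1) t)
                    (b (maxn i 1) (maxn j 1) t) (p i j)) A b.
Proof.
move=> e0 net rat start rot hv hh.
pose q t i j := rigid_motion (A (maxn i 1) (maxn j 1) t)
  (b (maxn i 1) (maxn j 1) t) (p i j).
have face i j t : (i < m)%N -> (j < k)%N ->
    let g := rigid_motion (A i.+1 j.+1 t) (b i.+1 j.+1 t) in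
    [/\ q t i j = g (p i j), q t i j.+1 = g (p i j.+1),
        q t i.+1 j.+1 = g (p i.+1 j.+1) & q t i.+1 j = g (p i.+1 j)].
  move=> hi hj /=; rewrite /q; case: i hi => [|i] hi; case: j hj => [|j] hj;
    rewrite ?maxnS ?maxn0 ?max0n; split=> //.
  - by have [] := hv 0%N j t hi hj.
  - by have [] := hv 0%N j t hi hj.
  - by have [] := hh i 0%N t hi hj.
  - by have [] := hh i 0%N t hi hj.
  (* The position is read off the diagonally opposite face at this vertex, so two edges have to be
     crossed. *)
  - have [_ ->] := hv i j t (ltnW hi) hj.
    by have [-> _] := hh i j.+1 t hi hj.
  - by have [_] := hh i j.+1 t hi hj.
  - by have [_] := hv i.+1 j t hi hj.
split=> //.
- move=> t _ [|i] [|j] // hi hj; have [q1 q2 q3 q4] := face i j t hi hj.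
  rewrite -!/(q t _ _) /= q1 q2 q3 q4.
  exact: rigid_motion_quadrilateral (net i.+1 j.+1 hi hj).
- move=> i j _ _; have [-> ->] := start (maxn i 1) (maxn j 1).
  by rewrite /rigid_motion mulmx1 addr0.
- move=> i j _ _; have [hA hb] := rat (maxn i 1) (maxn j 1).
  apply: rational_smooth; apply: rational_add hb.
  exact: rational_mul (rational_cst _) hA.
- by move=> i j _ _; have [hA hb] := rat i j; split; exact: rational_smooth.
- by move=> [|i] [|j] // hi hj t _; exact: face.
Qed.

(** A rotation about the line through [u] and [v] may be based at either point; this allows
    comparing motions with different base points at a common vertex. *)
Lemma rigid_motion_about A u v x : (v - u) *m A = v - u ->
  rigid_motion A (u - u *m A) x = v + (x - v) *m A.
Proof.
move=> h; have E : v *m A = v - u + u *m A by rewrite -h mulmxBl subrK.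
by rewrite /rigid_motion mulmxBl E; vec_eq.
Qed.

End Gluing.

Section Flexibility.
Variable R : realType.
Implicit Types (u v w x o : 'rV[R]_3) (A : 'M[R]_3).

Lemma agree_about A A' o o' v x :
  (v - o) *m A = v - o -> (v - o') *m A' = v - o' ->
  (x - v) *m A = (x - v) *m A' ->
  agree A (o - o *m A) A' (o' - o' *m A') x.
Proof.
by move=> h h' hx; rewrite /agree (rigid_motion_about _ h) (rigid_motion_about
  _ h') hx.
Qed.

Lemma rodrigues_parallel t (k : R) v : v *m rodrigues (t *: (k *: v)) = v.
Proof. by rewrite scalerA rodrigues_axis. Qed.

Lemma rodrigues_antiparallel t (k : R) u v :
  (u - v) *m rodrigues (t *: (k *: (v - u))) = u - v.
Proof. by rewrite -opprB mulNmx rodrigues_parallel. Qed.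

Lemma flexible_3x3 (p : nat -> nat -> 'rV[R]_3) (kb kr kt kl : R)
    (s1 s1' s2 s2' s3 s3' s4 s4' : R) :
  let Rb t := rodrigues (t *: (kb *: (p 1 2 - p 1 1)))%N in
  let Rr t := rodrigues (t *: (kr *: (p 2 2 - p 1 2)))%N in
  let Rt t := rodrigues (t *: (kt *: (p 2 1 - p 2 2)))%N in
  let Rl t := rodrigues (t *: (kl *: (p 1 1 - p 2 1)))%N in
  conjugate_net 3 3 p -> kb *: (p 1%N 2%N - p 1%N 1%N) != 0 ->
  (forall t, rodrigues (t *: (s1 *: (p 0%N 1%N - p 1%N 1%N))) *m Rb t =
             rodrigues (t *: (s1' *: (p 1%N 0%N - p 1%N 1%N))) *m Rl t) ->
  (forall t, rodrigues (t *: (s2 *: (p 1%N 3%N - p 1%N 2%N))) *m Rr t =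
             rodrigues (t *: (s2' *: (p 0%N 2%N - p 1%N 2%N))) *m Rb t) ->
  (forall t, rodrigues (t *: (s3 *: (p 3%N 2%N - p 2%N 2%N))) *m Rt t =
             rodrigues (t *: (s3' *: (p 2%N 3%N - p 2%N 2%N))) *m Rr t) ->
  (forall t, rodrigues (t *: (s4 *: (p 2%N 0%N - p 2%N 1%N))) *m Rl t =
             rodrigues (t *: (s4' *: (p 3%N 1%N - p 2%N 1%N))) *m Rt t) ->
  flexible 3 3 p.
Proof.
move=> Rb Rr Rt Rl net wb0 C11 C12 C22 C21.
(* The left factor acts first. By construction a corner face is hinged to one of its two neighbours;
   [C11], [C12], [C22], [C21] make it fit the other one. *)
pose A (i j : nat) (t : R) : 'M[R]_3 := match i, j with
  | 1, 1 => rodrigues (t *: (s1 *: (p 0%N 1%N - p 1%N 1%N))) *m Rb t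
  | 1, 2 => Rb t
  | 1, 3 => rodrigues (t *: (s2 *: (p 1%N 3%N - p 1%N 2%N))) *m Rr t
  | 2, 1 => Rl t
  | 2, 3 => Rr t
  | 3, 1 => rodrigues (t *: (s4 *: (p 2%N 0%N - p 2%N 1%N))) *m Rl t
  | 3, 2 => Rt t
  | 3, 3 => rodrigues (t *: (s3 *: (p 3%N 2%N - p 2%N 2%N))) *m Rt t
  | _, _ => 1%:M
  end%N.
(* A vertex shared by the face and the central one; it stays fixed. *)
pose o (i j : nat) := p (if i is i'.+2 then 2 else 1)%N (if j is j'.+2 then 2
  else 1)%N.
pose b i j t := o i j - o i j *m A i j t.
have rat i j : rational_family (A i j) /\ rational_family (b i j).
  have rA : rational_family (A i j).
    by case: i j => [|[|[|[|i]]]] [|[|[|[|j]]]]; rewrite /A;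
      try exact: rational_cst; try exact: rational_rodrigues;
      apply: rational_mul; exact: rational_rodrigues.
  split=> //; apply: rational_add (rational_cst _) _.
  exact: rational_opp (rational_mul (rational_cst _) rA).
have rodr0 w : rodrigues (0 *: w) = 1%:M.
  rewrite scale0r /rodrigues quat_mx_scalar expr1n dotE !mxE !mul0r !addr0.
  by rewrite invr1 scale1r.
have start i j : A i j 0 = 1%:M /\ b i j 0 = 0.
  have A0 : A i j 0 = 1%:M.
    by case: i j => [|[|[|[|i]]]] [|[|[|[|j]]]];
      rewrite /A /Rb /Rr /Rt /Rl ?rodr0 ?mulmx1.
  by split=> //; rewrite /b A0 mulmx1 subrr.
have rot i j t : rotation (A i j t).
  case: i j => [|[|[|[|i]]]] [|[|[|[|j]]]]; rewrite /A;
    by [exact: rotation1 | exact: rodrigues_rotation |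
        apply: rotationM; exact: rodrigues_rotation].
have A12 : A 1%N 2%N = Rb by [].
have A22 : A 2%N 2%N = fun=> 1%:M by [].
have fb t : (p 1%N 1%N - p 1%N 2%N) *m A 1%N 2%N t = (p 1%N 1%N - p 1%N 2%N).
  exact: rodrigues_antiparallel.
have fr t : (p 1%N 2%N - p 2%N 2%N) *m A 2%N 3%N t = (p 1%N 2%N - p 2%N 2%N).
  exact: rodrigues_antiparallel.
have ft t : (p 2%N 1%N - p 2%N 2%N) *m A 3%N 2%N t = (p 2%N 1%N - p 2%N 2%N).
  exact: rodrigues_parallel.
have fl t : (p 1%N 1%N - p 2%N 1%N) *m A 2%N 1%N t = (p 1%N 1%N - p 2%N 1%N).
  exact: rodrigues_parallel.
have g01 t : (p 0%N 1%N - p 1%N 1%N) *m A 1%N 1%N t = (p 0%N 1%N - p 1%N 1%N)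
  *m A 1%N 2%N t.
  by rewrite /A mulmxA rodrigues_parallel.
have g10 t : (p 1%N 0%N - p 1%N 1%N) *m A 1%N 1%N t = (p 1%N 0%N - p 1%N 1%N)
  *m A 2%N 1%N t.
  by rewrite /A C11 mulmxA rodrigues_parallel.
have g02 t : (p 0%N 2%N - p 1%N 2%N) *m A 1%N 2%N t = (p 0%N 2%N - p 1%N 2%N)
  *m A 1%N 3%N t.
  by rewrite /A C12 mulmxA rodrigues_parallel.
have g13 t : (p 1%N 3%N - p 1%N 2%N) *m A 1%N 3%N t = (p 1%N 3%N - p 1%N 2%N)
  *m A 2%N 3%N t.
  by rewrite /A mulmxA rodrigues_parallel.
have g32 t : (p 3%N 2%N - p 2%N 2%N) *m A 3%N 2%N t = (p 3%N 2%N - p 2%N 2%N)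
  *m A 3%N 3%N t.
  by rewrite /A mulmxA rodrigues_parallel.
have g23 t : (p 2%N 3%N - p 2%N 2%N) *m A 2%N 3%N t = (p 2%N 3%N - p 2%N 2%N)
  *m A 3%N 3%N t.
  by rewrite /A C22 mulmxA rodrigues_parallel.
have g20 t : (p 2%N 0%N - p 2%N 1%N) *m A 2%N 1%N t = (p 2%N 0%N - p 2%N 1%N)
  *m A 3%N 1%N t.
  by rewrite /A mulmxA rodrigues_parallel.
have g31 t : (p 3%N 1%N - p 2%N 1%N) *m A 3%N 1%N t = (p 3%N 1%N - p 2%N 1%N)
  *m A 3%N 2%N t.
  by rewrite /A C21 mulmxA rodrigues_parallel.
have fixed22 u t : u *m A 2%N 2%N t = u by rewrite A22 mulmx1.
have zz A' (u : 'rV[R]_3) : (u - u) *m A' = u - u by rewrite subrr mul0mx.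
have z2 A' A'' (u : 'rV[R]_3) : (u - u) *m A' = (u - u) *m A''.
  by rewrite subrr !mul0mx.
clearbody A.
(* The motions are defined for all times, so any positive bound would do. *)
exists 1; eexists; exists A, b; split.
  apply: deformation_of_motions => //.
    move=> [|[|[|//]]] [|[|//]] t _ _; split.
    - exact: (agree_about (zz _ _) (fb t) (g01 t)).
    - exact: (agree_about (zz _ _) (fb t) (z2 _ _ _)).
    - exact: (agree_about (zz _ _) (zz _ _) (g02 t)).
    - exact: (agree_about (zz _ _) (zz _ _) (z2 _ _ _)).
    - exact: (agree_about (fl t) (fixed22 _ t) (z2 _ _ _)).
    - exact: (agree_about (zz _ _) (fixed22 _ t) (z2 _ _ _)).
    - exact: (agree_about (fixed22 _ t) (fr t) (z2 _ _ _)).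
    - exact: (agree_about (zz _ _) (zz _ _) (z2 _ _ _)).
    - exact: (agree_about (zz _ _) (ft t) (z2 _ _ _)).
    - exact: (agree_about (zz _ _) (ft t) (g31 t)).
    - exact: (agree_about (zz _ _) (zz _ _) (z2 _ _ _)).
    - exact: (agree_about (zz _ _) (zz _ _) (g32 t)).
  move=> [|[|//]] [|[|[|//]]] t _ _; split.
  - exact: (agree_about (zz _ _) (fl t) (g10 t)).
  - exact: (agree_about (zz _ _) (fl t) (z2 _ _ _)).
  - exact: (agree_about (fb t) (fixed22 _ t) (z2 _ _ _)).
  - exact: (agree_about (zz _ _) (fixed22 _ t) (z2 _ _ _)).
  - exact: (agree_about (zz _ _) (fr t) (z2 _ _ _)).
  - exact: (agree_about (zz _ _) (fr t) (g13 t)).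
  - exact: (agree_about (zz _ _) (zz _ _) (g20 t)).
  - exact: (agree_about (zz _ _) (zz _ _) (z2 _ _ _)).
  - exact: (agree_about (fixed22 _ t) (ft t) (z2 _ _ _)).
  - exact: (agree_about (zz _ _) (zz _ _) (z2 _ _ _)).
  - exact: (agree_about (zz _ _) (zz _ _) (z2 _ _ _)).
  - exact: (agree_about (zz _ _) (zz _ _) (g23 t)).
(* At any nonzero time the lower neighbour has turned relative to the central face. *)
have h : - 1 < (2^-1 : R) < 1 by apply/andP; split; lra.
move=> /(_ 1%N 2%N 2%N 2%N isT isT isT isT _ h) [+ _]; rewrite A12 A22.
move=> /rodrigues_eq1/eqP; rewrite scaler_eq0 (negPf wb0) orbF.
by apply/negP; rewrite invr_eq0 pnatr_eq0.
Qed.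

End Flexibility.

(** * Flexibility of the two 3 x 3 subnets *)

Section Subnets.
Variable R : realType.
Implicit Types (u v w x o : 'rV[R]_3) (A : 'M[R]_3).

Lemma enormN v : enorm (- v) = enorm v.
Proof. by rewrite /enorm dotNl dotNr opprK. Qed.

Lemma unit_vecN v : unit_vec (- v) = - unit_vec v.
Proof. by rewrite /unit_vec enormN scalerN. Qed.

Lemma scale_unit (c : R) u : c *: unit_vec u = (c / enorm u) *: u.
Proof. by rewrite scalerA. Qed.

Lemma scale_unitN (c : R) u v : (- c) *: unit_vec (v - u) = c *: unit_vec (u -
  v).
Proof. by rewrite -(opprB u) unit_vecN scalerN scaleNr opprK. Qed.

(* Around the central face the rotation about each edge has the same axis at
   both ends, so a half-angle tangent changes sign with the direction. *)
Lemma flexible_of_closes (p : nat -> nat -> 'rV[R]_3) (tb tr tt tl : R) :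
  let dir i j i' j' := unit_vec (p i' j' - p i j) in
  conjugate_net 3 3 p -> tb != 0 -> p 1%N 2%N - p 1%N 1%N != 0 ->
  closes (dir 1 1 1 2)%N (dir 1 1 2 1)%N (dir 1 1 0 1)%N (dir 1 1 1 0)%N tb (-
    tl) ->
  closes (dir 1 2 2 2)%N (dir 1 2 1 1)%N (dir 1 2 1 3)%N (dir 1 2 0 2)%N tr (-
    tb) ->
  closes (dir 2 2 2 1)%N (dir 2 2 1 2)%N (dir 2 2 3 2)%N (dir 2 2 2 3)%N tt (-
    tr) ->
  closes (dir 2 1 1 1)%N (dir 2 1 2 2)%N (dir 2 1 2 0)%N (dir 2 1 3 1)%N tl (-
    tt) ->
  flexible 3 3 p.
Proof.
move=> dir net tb0 pb [s1 [s1' h1]] [s2 [s2' h2]] [s3 [s3' h3]] [s4 [s4' h4]].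
move: h1 h2 h3 h4; rewrite /dir !scale_unitN !scale_unit => h1 h2 h3 h4.
apply: (flexible_3x3 net _ h1 h2 h3 h4).
by rewrite scaler_eq0 negb_or pb mulf_neq0 // invr_neq0 // gt_eqF ?enorm_gt0.
Qed.

Lemma corner_shift2 (n : 'rV[R]_3) (x y : R) e1 e2 f1 f2 : x != 0 -> y != 0 ->
  flat_corner n x y e1 e2 f1 f2 -> flat_corner n x^-1 y^-1 f2 f1 e2 e1.
Proof. by move=> x0 y0 h; apply/(corner_shift x0)/(corner_shift y0 h). Qed.

Lemma corner_shift3 (n : 'rV[R]_3) (x y : R) e1 e2 f1 f2 : x != 0 -> y != 0 ->
  flat_corner n x y e1 e2 f1 f2 -> flat_corner n y x^-1 f1 e1 f2 e2.
Proof.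
move=> x0 y0 h; rewrite -[y in flat_corner _ y]invrK.
by apply: corner_shift; [rewrite invr_neq0|exact: corner_shift2].
Qed.

Lemma prescribed_subnets_flexible (p : nat -> nat -> 'rV[R]_3) :
  prescribed_net p ->
  flexible 3 3 (drop_columns 0 p) /\ flexible 3 3 (drop_columns 1 p).
Proof.
move=> net.
have [n [hn hp hf]] := planar_net_orientation (isT : 0 < 3)%N (isT : 0 < 4)%N
  (prescribed_planar net) (prescribed_convex net) (prescribed_dihedral net).
have corner i j (x y x' y' : R) : (i.+1 < 3)%N -> (j.+1 < 4)%N ->
    0 < x -> 0 < y -> y * y' = 1 -> x * x' = 1 ->
    half_angle_tangents p i.+1 j.+1 x y y' x' ->
    let u := unit_vec (p i.+2 j.+1 - p i.+1 j.+1) in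
    let l := unit_vec (p i.+1 j - p i.+1 j.+1) in
    let r := unit_vec (p i.+1 j.+2 - p i.+1 j.+1) in
    let d := unit_vec (p i j.+1 - p i.+1 j.+1) in
    [/\ flat_corner n x y u l r d, flat_corner n y' x l d u r,
        flat_corner n x' y' d r l u & flat_corner n y x' r u d l].
  move=> hi hj x0 y0 /mulr1_eq <- /mulr1_eq <- hh u l r d.
  have c := net_corner hn hp hf hi hj x0 y0 hh.
  have [x1 y1] := (lt0r_neq0 x0, lt0r_neq0 y0).
  by split; [|exact: corner_shift|exact: corner_shift2|exact: corner_shift3].
have nz j : (j < 3)%N -> p 1%N j.+2 - p 1%N j.+1 != 0.
  move=> hj; have [+ _ _ _] := hf 1%N j.+1 isT hj; exact: turn_neq.
have conj := prescribed_conjugate net.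
have [ul11 ll11 lr11 ur11] := corner 0%N 0%N (2) (3/2) (1/2) (2/3) isT isT
  ltac:(clear; lra) ltac:(clear; lra) ltac:(clear; lra) ltac:(clear; lra)
  (prescribed_11 net).
have [ul12 ll12 lr12 ur12] := corner 0%N 1%N (2/3) (7/6) (3/2) (6/7) isT isT
  ltac:(clear; lra) ltac:(clear; lra) ltac:(clear; lra) ltac:(clear; lra)
  (prescribed_12 net).
have [ul13 ll13 lr13 ur13] := corner 0%N 2%N (3/2) (51/76) (2/3) (76/51) isT isT
  ltac:(clear; lra) ltac:(clear; lra) ltac:(clear; lra) ltac:(clear; lra)
  (prescribed_13 net).
have [ul21 ll21 lr21 ur21] := corner 1%N 0%N (1/2) (3/2) (2) (2/3) isT isT
  ltac:(clear; lra) ltac:(clear; lra) ltac:(clear; lra) ltac:(clear; lra)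
  (prescribed_21 net).
have [ul22 ll22 lr22 ur22] := corner 1%N 1%N (3/2) (2) (2/3) (1/2) isT isT
  ltac:(clear; lra) ltac:(clear; lra) ltac:(clear; lra) ltac:(clear; lra)
  (prescribed_22 net).
have [ul23 ll23 lr23 ur23] := corner 1%N 2%N (7/4) (7/6) (4/7) (6/7) isT isT
  ltac:(clear; lra) ltac:(clear; lra) ltac:(clear; lra) ltac:(clear; lra)
  (prescribed_23 net).
split.
  (* The numbers belong to the bottom, right, top and left edges of the central face. Top to bottom
     is 1/4, the quotient common to the first two columns. A quarter turn of the corner exchanges
     the two modes, so their numbers depend on the face from which a vertex is read. *)
  apply: (@flexible_of_closes _ 8 (-1) 2 4).
  - by move=> i [//|j] hi hj; apply: (conj i j.+1 hi); exact: leqW.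
  - by rewrite pnatr_eq0.
  - exact: (nz 0%N isT).
  - by apply: (closes_mode1 ur11); clear; lra.
  - by apply: (closes_mode2 ul12); clear; lra.
  - by apply: (closes_mode1 ll22); clear; lra.
  - by apply: (closes_mode1 lr21); clear; lra.
(* Top to bottom is 11/21, the quotient common to the last two columns; the ratios at the four
   vertices are 11/3, 55/21, 5 and 7. *)
apply: (@flexible_of_closes _ 21 55 11 77).
- by move=> i [//|j] hi hj; exact: (conj i j.+2 hi).
- by rewrite pnatr_eq0.
- exact: (nz 1%N isT).
- by apply: (closes_mode2 ur12); clear; lra.
- by apply: (closes_mode1 ul13); clear; lra.
- by apply: (closes_mode2 ll23); clear; lra.
- by apply: (closes_mode1 lr22); clear; lra.
Qed.

End Subnets.

(** * An explicit net *)

Section PositiveNets.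
Variable R : realType.
Implicit Types (n u v w x o : 'rV[R]_3).

Lemma turn_segment n (a b x y : 'rV[R]_3) (s : R) :
  turn n a b (x + s *: (y - x)) = (1 - s) * turn n a b x + s * turn n a b y.
Proof. by rewrite /turn; vec_ring. Qed.

Lemma turn_last n (a b : 'rV[R]_3) : turn n a b b = 0.
Proof. by rewrite /turn; vec_ring. Qed.

Lemma turn_first n (a b : 'rV[R]_3) : turn n a b a = 0.
Proof. by rewrite /turn; vec_ring. Qed.

(** The affine function [turn n a b] vanishes on the side ab and is positive on cd. *)
Lemma disjoint_sides n (a b c d : 'rV[R]_3) : 0 < turn n a b c ->
  0 < turn n a b d -> closed_segment a b `&` closed_segment c d = set0.
Proof.
move=> hc hd; apply/seteqP; split=> // x [[s _ xs] [r /andP[r0 r1] xr]].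
have : turn n a b x = 0 by rewrite xs turn_segment turn_first turn_last; ring.
rewrite xr turn_segment => E.
have h1 : 0 <= (1 - r) * turn n a b c by rewrite mulr_ge0 ?subr_ge0 // ltW.
have h2 : 0 <= r * turn n a b d by rewrite mulr_ge0 // ltW.
have [r00|r00] := eqVneq r 0; first by move: E; rewrite r00; lra.
have : 0 < r * turn n a b d by rewrite mulr_gt0 // lt_neqAle eq_sym r00.
lra.
Qed.

Lemma consecutive_sides n (a b c : 'rV[R]_3) : 0 < turn n b c a ->
  closed_segment a b `&` closed_segment b c = [set b].
Proof.
move=> ha; apply/seteqP; split=> [x [[s _ xs] [r _ xr]]|_ ->].
  have : turn n b c x = 0 by rewrite xr turn_segment turn_first turn_last; ring.
  rewrite xs turn_segment turn_first mulr0 addr0 => /eqP.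
  rewrite mulf_eq0 (gt_eqF ha) orbF subr_eq0 => /eqP <-.
  by rewrite scale1r addrC subrK.
by split; [exists 1 | exists 0]; rewrite ?lexx ?ler01 //; vec_eq.
Qed.

Lemma positive_quadrilateral n (a b c d : 'rV[R]_3) :
  coplanar [set a; b; c; d] -> positive_face n a b c d ->
  planar_quadrilateral a b c d.
Proof.
move=> hcop [h1 h2 h3 h4].
have h1' : 0 < turn n d a b by rewrite -(turn_rot n d a b).
have h2' : 0 < turn n a b c by rewrite -(turn_rot n a b c).
have h3' : 0 < turn n b c d by rewrite -(turn_rot n b c d).
have h4' : 0 < turn n c d a by rewrite -(turn_rot n c d a).
split=> //; split.
- have neq (x y z : 'rV[R]_3) : 0 < turn n x y z -> [/\ y != x, z != x & y !=
  z].
    move=> h; split; apply: contraTneq h => ->; rewrite ?turn_last ?turn_first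
      ?ltxx //.
    by rewrite (_ : turn _ _ _ _ = 0) ?ltxx //; rewrite /turn; vec_ring.
  have [ba da bd] := neq _ _ _ h1.
  have [cb _ ca] := neq _ _ _ h2.
  have [dc _ _] := neq _ _ _ h3.
  by rewrite /= !inE !negb_or (eq_sym a b) ba (eq_sym a c) ca (eq_sym a d) da
    (eq_sym b c) cb bd (eq_sym c d) dc.
- exact: disjoint_sides h2' h1.
- exact: disjoint_sides h3' h2.
split; [exact: consecutive_sides h2|exact: consecutive_sides h3
  |exact: consecutive_sides h4|exact: consecutive_sides h1].
Qed.

Section Net.
Variables (m k : nat) (p : nat -> nat -> 'rV[R]_3) (n : 'rV[R]_3).
Hypothesis hn : dot n n = 1.
Hypothesis hp : forall i j, dot n (p i j) = 0.
Hypothesis hf : forall i j, (i < m)%N -> (j < k)%N ->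
  positive_face n (p i j) (p i j.+1) (p i.+1 j.+1) (p i.+1 j).

Let n0 : n != 0.
Proof. by rewrite -dot_gt0 hn. Qed.

Let perp i j i' j' : dot n (p i j - p i' j') = 0.
Proof. by rewrite dotBr !hp subrr. Qed.

Lemma positive_conjugate_net : conjugate_net m k p.
Proof.
move=> [|i] [|j] // hi hj; apply: positive_quadrilateral (hf hi hj).
by exists n, 0; split=> // x [[[->|->]|->]|->].
Qed.

Lemma positive_planar_net : planar_net m k p.
Proof. by exists n, 0; split=> // x [i [j [_ _ ->]]]. Qed.

Lemma positive_strictly_convex : strictly_convex_faces m k p.
Proof.
move=> [|i] [|j] // hi hj; have [h1 h2 h3 h4] := hf hi hj.
by split; rewrite /same_side (dot_turns hn) // mulr_gt0 //; rewrite -turn_rot.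
Qed.

Lemma positive_zero_dihedrals : zero_dihedrals m k p.
Proof.
have cop i1 i2 i3 i4 i5 i6 j1 j2 j3 j4 j5 j6 :
    coplanar [set p i1 j1; p i2 j2; p i3 j3; p i4 j4; p i5 j5; p i6 j6].
  by exists n, 0; split=> // x [[[[[->|->]|->]|->]|->]|->].
split=> [[|i] [|j]|[|i] [|j]] //= hi hj; split=> //.
  have [a1 a2 a3 a4] := hf (ltnW hi) hj.
  have [b1 b2 _ _] := hf hi hj.
  have b2' : 0 < turn n (p i.+1 j) (p i.+1 j.+1) (p i.+2 j.+1).
    by rewrite -turn_rot.
  have a4' : turn n (p i.+1 j) (p i.+1 j.+1) (p i j) < 0.
    by rewrite turn_swap oppr_lt0.
  have a3' : turn n (p i.+1 j) (p i.+1 j.+1) (p i j.+1) < 0.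
    by rewrite turn_swap oppr_lt0 -turn_rot -turn_rot.
  by split; rewrite /opposite_sides (dot_turns hn) // nmulr_rlt0.
have [a1 a2 a3 a4] := hf hi (ltnW hj).
have [b1 _ _ b4] := hf hi hj.
have a3' : 0 < turn n (p i j.+1) (p i.+1 j.+1) (p i.+1 j).
  by rewrite -(turn_rot n (p i j.+1)).
have b1' : turn n (p i j.+1) (p i.+1 j.+1) (p i j.+2) < 0.
  by rewrite turn_swap oppr_lt0.
have b4' : turn n (p i j.+1) (p i.+1 j.+1) (p i.+1 j.+2) < 0.
  by rewrite turn_swap oppr_lt0 turn_rot.
by split; rewrite /opposite_sides (dot_turns hn) // pmulr_rlt0.
Qed.

End Net.
End PositiveNets.

(** * Coordinates of a net with the prescribed angles *)

Section Example.
Variable R : realType.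
Implicit Types x y : R.

Definition pt (x y : R) : 'rV[R]_3 :=
  \row_(k < 3) (if k == 0 then x else if k == 1 then y else 0).

Lemma pt0 x y : pt x y 0 0 = x. Proof. by rewrite mxE. Qed.
Lemma pt1 x y : pt x y 0 1 = y. Proof. by rewrite mxE. Qed.
Lemma pt2 x y : pt x y 0 2%:R = 0. Proof. by rewrite mxE. Qed.

Definition ez : 'rV[R]_3 := delta_mx 0 2%:R.

Lemma ez0 : ez 0 0 = 0. Proof. by rewrite mxE. Qed.
Lemma ez1 : ez 0 1 = 0. Proof. by rewrite mxE. Qed.
Lemma ez2 : ez 0 2%:R = 1. Proof. by rewrite mxE. Qed.

Lemma turn_pt (x y x' y' x'' y'' : R) :
  turn ez (pt x y) (pt x' y') (pt x'' y'') =
  (x' - x) * (y'' - y) - (y' - y) * (x'' - x).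
Proof. by rewrite /turn !vecE ez0 ez1 ez2 !pt0 !pt1; ring. Qed.

Lemma dot_pt (x y a b c d : R) :
  dot (pt a b - pt x y) (pt c d - pt x y) =
  (a - x) * (c - x) + (b - y) * (d - y).
Proof. by rewrite !vecE !pt0 !pt1 !pt2; ring. Qed.

(** [r] and [s] are the lengths of the two sides of the angle. As these are rational in the example,
    no square root survives and each angle becomes an identity between rational numbers. *)
Lemma tan_half_angle (x y a b c d r s z : R) : 0 < r -> 0 < s -> 0 < z ->
  (a - x) ^+ 2 + (b - y) ^+ 2 = r ^+ 2 ->
  (c - x) ^+ 2 + (d - y) ^+ 2 = s ^+ 2 ->
  ((a - x) * (c - x) + (b - y) * (d - y)) * (1 + z ^+ 2) =
    r * s * (1 - z ^+ 2) ->
  tan (angle (pt a b) (pt x y) (pt c d) / 2) = z.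
Proof.
move=> r0 s0 z0 hr hs h; rewrite /angle.
have -> : enorm (pt a b - pt x y) = r.
  by rewrite /enorm dot_pt -!expr2 hr sqrtr_sqr gtr0_norm.
have -> : enorm (pt c d - pt x y) = s.
  by rewrite /enorm dot_pt -!expr2 hs sqrtr_sqr gtr0_norm.
rewrite dot_pt; set D := _ + _ in h *.
have -> : D / (r * s) = cos2 z.
  have nz := sqr1D_neq0 z.
  have -> : D = r * s * (1 - z ^+ 2) / (1 + z ^+ 2).
    by rewrite -h mulfK.
  by rewrite /cos2; field; rewrite nz !gt_eqF.
exact: tan_half_acos.
Qed.

(* All edges at the interior vertices have rational length.  Large constants
   are written with small numerals because numerals are unary. *)
Definition example_net (i j : nat) : 'rV[R]_3 :=
  match i, j with
  | 0%N, 0%N => pt (-30) (-60)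
  | 0%N, 1%N => pt 3 (-4)
  | 0%N, 2%N => pt 156 (-84)
  | 0%N, 3%N => pt ((129 * 1000 ^+ 2 + 653 * 1000 + 303) / 1000 / 100) ((1 *
    1000 ^+ 2 + 182 * 1000 + 519) / 625 / 10)
  | 0%N, 4%N => pt ((136 * 1000 ^+ 2 + 577 * 1000 + 733) / 1000 / 100) ((2 *
    1000 ^+ 2 + 572 * 1000 + 443) / 125 / 100)
  | 1%N, 0%N => pt (-33) (-56)
  | 1%N, 1%N => pt 0 0
  | 1%N, 2%N => pt 169 0
  | 1%N, 3%N => pt 1242 264
  | 1%N, 4%N => pt ((13 * 1000 ^+ 2 + 112 * 1000 + 443) / 1000 / 10) ((701 *
    1000 + 481) / 2500)
  | 2%N, 0%N => pt (-194) 60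
  | 2%N, 1%N => pt (-75) 180
  | 2%N, 2%N => pt 24 348
  | 2%N, 3%N => pt 1255 348
  | 2%N, 4%N => pt ((5 * 1000 + 191) / 4) 313
  | 3%N, 0%N => pt (-1807 / 5) (416 / 5)
  | 3%N, 1%N => pt (-1212 / 5) (1016 / 5)
  | 3%N, 2%N => pt 21 352
  | 3%N, 3%N => pt 1288 404
  | 3%N, 4%N => pt ((5 * 1000 + 323) / 4) 369
  | _, _ => 0
  end.

Lemma example_net_z i j : dot ez (example_net i j) = 0.
Proof.
case: i j => [|[|[|[|i]]]] [|[|[|[|[|j]]]]];
  by rewrite dotE ez0 ez1 ez2 /example_net ?pt2 ?zerov_E; ring.
Qed.

Lemma example_net_positive i j : (i < 3)%N -> (j < 4)%N ->
  positive_face ez (example_net i j) (example_net i j.+1)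
    (example_net i.+1 j.+1) (example_net i.+1 j).
Proof.
case: i j => [|[|[|//]]] [|[|[|[|//]]]] _ _;
  by rewrite /example_net; split; rewrite turn_pt; lra.
Qed.

Lemma example_net_11 : half_angle_tangents example_net 1 1 2 (3/2) (2/3) (1/2).
Proof.
split.
- by apply: (@tan_half_angle _ _ _ _ _ _ 195 65); lra.
- by apply: (@tan_half_angle _ _ _ _ _ _ 195 169); lra.
- by apply: (@tan_half_angle _ _ _ _ _ _ 5 65); lra.
- by apply: (@tan_half_angle _ _ _ _ _ _ 5 169); lra.
Qed.

Lemma example_net_12 : half_angle_tangents example_net 1 2 (2/3) (7/6) (6/7)
  (3/2).
Proof.
split.
- by apply: (@tan_half_angle _ _ _ _ _ _ 377 169); lra.
- by apply: (@tan_half_angle _ _ _ _ _ _ 377 1105); lra.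
- by apply: (@tan_half_angle _ _ _ _ _ _ 85 169); lra.
- by apply: (@tan_half_angle _ _ _ _ _ _ 85 1105); lra.
Qed.

Lemma example_net_13 : half_angle_tangents example_net 1 3 (3/2) (51/76)
  (76/51) (2/3).
Proof.
split.
- by apply: (@tan_half_angle _ _ _ _ _ _ 85 1105); lra.
- by apply: (@tan_half_angle _ _ _ _ _ _ 85 ((142 * 1000 + 409) / 2000)); lra.
- by apply: (@tan_half_angle _ _ _ _ _ _ ((1 * 1000 ^+ 2 + 851 * 1000 + 317) /
  1000 / 20) 1105); lra.
- by apply: (@tan_half_angle _ _ _ _ _ _ ((1 * 1000 ^+ 2 + 851 * 1000 + 317) /
  1000 / 20) ((142 * 1000 + 409) / 2000)); lra.
Qed.

Lemma example_net_21 : half_angle_tangents example_net 2 1 (1/2) (3/2) (2/3) 2.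
Proof.
split.
- by apply: (@tan_half_angle _ _ _ _ _ _ 169 169); lra.
- by apply: (@tan_half_angle _ _ _ _ _ _ 169 195); lra.
- by apply: (@tan_half_angle _ _ _ _ _ _ 195 169); lra.
- by apply: (@tan_half_angle _ _ _ _ _ _ 195 195); lra.
Qed.

Lemma example_net_22 : half_angle_tangents example_net 2 2 (3/2) 2 (1/2) (2/3).
Proof.
split.
- by apply: (@tan_half_angle _ _ _ _ _ _ 5 195); lra.
- by apply: (@tan_half_angle _ _ _ _ _ _ 5 1231); lra.
- by apply: (@tan_half_angle _ _ _ _ _ _ 377 195); lra.
- by apply: (@tan_half_angle _ _ _ _ _ _ 377 1231); lra.
Qed.

Lemma example_net_23 : half_angle_tangents example_net 2 3 (7/4) (7/6) (6/7)
  (4/7).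
Proof.
split.
- by apply: (@tan_half_angle _ _ _ _ _ _ 65 1231); lra.
- by apply: (@tan_half_angle _ _ _ _ _ _ 65 (221 / 4)); lra.
- by apply: (@tan_half_angle _ _ _ _ _ _ 85 1231); lra.
- by apply: (@tan_half_angle _ _ _ _ _ _ 85 (221 / 4)); lra.
Qed.

Lemma example_prescribed : prescribed_net example_net.
Proof.
have nez : dot ez ez = 1 by rewrite dotE ez0 ez1 ez2; ring.
split.
- exact: positive_conjugate_net nez example_net_z example_net_positive.
- exact: positive_planar_net nez example_net_z.
- exact: positive_strictly_convex nez example_net_z example_net_positive.
- exact: positive_zero_dihedrals nez example_net_z example_net_positive.
- exact: example_net_11.
- exact: example_net_12.
- exact: example_net_13.
- exact: example_net_21.
- exact: example_net_22.
- exact: example_net_23.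
Qed.

End Example.

Theorem theorem7 (R : realType) :
  (exists p : nat -> nat -> 'rV[R]_3, prescribed_net p) /\
  (forall p : nat -> nat -> 'rV[R]_3, prescribed_net p ->
     [/\ ~ flexible 3 4 p,
         flexible 3 3 (drop_columns 0 p) &
         flexible 3 3 (drop_columns 1 p)]).
Proof.
split; first by exists (@example_net R); exact: example_prescribed.
move=> p net; have [flex0 flex1] := prescribed_subnets_flexible net.
by split=> //; exact: prescribed_net_rigid.
Qed.
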